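(* Let $(\mathbf{X},Y)$, $\mathbf{X}=(X_1,\dots,X_d)$, be a $(d+1)$-dimensional random vector with continuous univariate marginal distribution functions and connecting copula $A\in\mathcal{C}^{d+1}$, and let $Q(Y,\mathbf{X}):=\gamma(\psi(A))$. Then $$Q(Y,\mathbf{X})=2\int_{\mathbb{I}}\int_{\mathbb{I}^d}\Big(K_A(\mathbf{u},[0,t])-\big(1-K_A(\mathbf{u},[0,1-t])\big)\Big)^2\,\mathrm{d}\mu_{A^{1:d}}(\mathbf{u})\,\mathrm{d}\lambda(t)\ \ge 0,$$ and the following properties hold: (i) $Q(Y,\mathbf{X})=1$ if and only if $Y$ is completely dependent on $\mathbf{X}$; (ii) $Q(Y,\mathbf{X})=0$ if and only if $(\mathbf{X},Y)$ and $(\mathbf{X},-Y)$ have the same copula; in particular, $Q(Y,\mathbf{X})=0$ if $Y$ and $\mathbf{X}$ are independent; (iii) $Q(Y,\mathbf{X})$ is invariant with respect to permutations of $X_1,\dots,X_d$; (iv) $Q(Y,\mathbf{X})$ is invariant with respect to continuous and strictly monotone (coordinatewise) transformations of $X_1,\dots,X_d$.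
   Context: Let $\mathbb{I}=[0,1]$, $d\ge 1$ an integer, $\lambda$ Lebesgue measure on $\mathbb{I}$. $\mathcal{C}^{k}$ is the family of all $k$-dimensional copulas. For $A\in\mathcal{C}^{d+1}$, $\mu_A$ denotes the probability measure on $\mathbb{I}^{d+1}$ with distribution function $A$; $A^{1:d}$ is the marginal of $A$ with respect to the first $d$ coordinates (for $d=1$, $\mu_{A^{1:d}}=\lambda$); $K_A:\mathbb{I}^d\times\mathcal{B}(\mathbb{I})\to\mathbb{I}$ is (a version of) the Markov kernel of $A$, i.e. the regular conditional distribution of the last coordinate given the first $d$ coordinates. The map $\psi:\mathcal{C}^{d+1}\to\mathcal{C}^2$ is defined by $$\psi(A)(s,t)=\int_{\mathbb{I}^d}K_A(\mathbf{u},[0,s])\,K_A(\mathbf{u},[0,t])\,\mathrm{d}\mu_{A^{1:d}}(\mathbf{u}),\qquad (s,t)\in\mathbb{I}^2.$$ $\gamma:\mathcal{C}^2\to\mathbb{R}$ is Gini's gamma, $\gamma(C)=4\int_{\mathbb{I}}\big(C(t,t)+C(t,1-t)\big)\,\mathrm{d}\lambda(t)-2$. $Y$ is completely dependent on $\mathbf{X}$ if there is a measurable function $f$ with $P(Y=f(\mathbf{X}))=1$. The (connecting) copula of a random vector with continuous marginals is the distribution function of the vector obtained by applying to each coordinate its own distribution function. *)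

(* Defs.v *)
From mathcomp Require Export all_boot all_order all_algebra perm.
From mathcomp Require Export all_classical all_reals all_analysis.
From mathcomp Require Export measurable_realfun.

Set Implicit Arguments.
Unset Strict Implicit.
Unset Printing Implicit Defensive.

Export Order.TTheory GRing.Theory Num.Theory.
Export numFieldNormedType.Exports.

Local Open Scope classical_set_scope.
Local Open Scope ring_scope.

Definition cube (R : realType) (k : nat) : set (k.-tuple R) :=
  [set u | forall i, 0 <= tnth u i <= 1].

Definition orthant (R : realType) (k : nat) (u : k.-tuple R) :
    set (k.-tuple R) :=
  [set v | forall i, tnth v i <= tnth u i].

(* Points of I^k are tuples of reals, and a copula of dimension k is given by a
   function C : k.-tuple R -> R of which only the values on the cube matter. *)
Definition is_measure_of (R : realType) (k : nat) (C : k.-tuple R -> R)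
    (mu : probability (k.-tuple R) R) : Prop :=
  mu (@cube R k) = 1%E /\ forall u, cube u -> mu (orthant u) = (C u)%:E.

(* mu_C is determined by C; the value is a junk Dirac mass when C is not the
   distribution function of any probability measure on the cube. *)
Definition copula_measure (R : realType) (k : nat) (C : k.-tuple R -> R) :
    probability (k.-tuple R) R :=
  if pselect (exists mu, is_measure_of C mu) is left h
  then projT1 (cid h) else \d_([tuple 0 | i < k] : k.-tuple R).

(* A^{1:d} *)
Definition margin_init (R : realType) (d : nat) (A : d.+1.-tuple R -> R) :
    d.-tuple R -> R :=
  fun u => A [tuple of rcons u 1].

Definition tuple_init (R : realType) (d : nat) (v : d.+1.-tuple R) :
    d.-tuple R :=
  [tuple tnth v (widen_ord (leqnSn d) i) | i < d].

(* K is a version of the Markov kernel K_A.  A kernel from I^d to I is seen as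
   a kernel from R^d to R whose values at points of I^d are carried by I; its
   values elsewhere are irrelevant. *)
Definition is_markov_kernel (R : realType) (d : nat) (A : d.+1.-tuple R -> R)
    (K : R.-pker (d.-tuple R) ~> R) : Prop :=
  (forall u, cube u -> K u `[0, 1]%classic = 1%E) /\
  forall (E : set (d.-tuple R)) (F : set R), measurable E -> measurable F ->
    (\int[copula_measure (margin_init A)]_(u in E) K u F =
     copula_measure A [set v | E (tuple_init v) /\ F (tnth v ord_max)])%E.

(* psi(A), computed with the version K of K_A; K does not affect the result. *)
Definition psi (R : realType) (d : nat) (A : d.+1.-tuple R -> R)
    (K : R.-pker (d.-tuple R) ~> R) : 2.-tuple R -> R :=
  fun p => \int[copula_measure (margin_init A)]_(u in @cube R d)
    (fine (K u `[0, tnth p ord0]%classic) * fine (K u `[0, tnth p ord_max]%classic)).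

Definition gini_gamma (R : realType) (C : 2.-tuple R -> R) : R :=
  4 * (\int[@lebesgue_measure R]_(t in `[0, 1])
         (C [tuple t; t] + C [tuple t; 1 - t])) - 2.

Section random_vectors.
Context (disp : measure_display) (T : measurableType disp) (R : realType)
  (P : probability T R).

Definition distr_fun (X : {RV P >-> R}) : R -> R := fun r => fine (cdf X r).

Definition connecting_copula (k : nat) (Z : 'I_k -> {RV P >-> R}) :
    k.-tuple R -> R :=
  fun u => fine (P [set w | forall i, distr_fun (Z i) (Z i w) <= tnth u i]).

(* the random vector (X_1, ..., X_d, Y) *)
Definition join_last (d : nat) (X : 'I_d -> {RV P >-> R})
    (Y : {RV P >-> R}) : 'I_d.+1 -> {RV P >-> R} :=
  fun i => if unlift ord_max i is Some j then X j else Y.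

Definition vec (d : nat) (X : 'I_d -> {RV P >-> R}) : T -> d.-tuple R :=
  fun w => [tuple X i w | i < d].

Definition completely_dependent (d : nat) (Y : {RV P >-> R})
    (X : 'I_d -> {RV P >-> R}) : Prop :=
  exists f : d.-tuple R -> R,
    measurable_fun setT f /\ P [set w | Y w = f (vec X w)] = 1%E.

Definition independent_of (d : nat) (Y : {RV P >-> R})
    (X : 'I_d -> {RV P >-> R}) : Prop :=
  forall (E : set (d.-tuple R)) (F : set R), measurable E -> measurable F ->
    P (vec X @^-1` E `&` Y @^-1` F) =
    (P (vec X @^-1` E) * P (Y @^-1` F))%E.

Definition same_copula (k : nat) (Z Z' : 'I_k -> {RV P >-> R}) : Prop :=
  forall u, cube u -> connecting_copula Z u = connecting_copula Z' u.

(* Q(Y, X), computed with the version K of the Markov kernel of the copula of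
   (X, Y) *)
Definition gini_Q (d : nat) (Y : {RV P >-> R}) (X : 'I_d -> {RV P >-> R})
    (K : R.-pker (d.-tuple R) ~> R) : R :=
  gini_gamma (psi (connecting_copula (join_last X Y)) K).

End random_vectors.

Definition strictly_monotone (R : realType) (f : R -> R) : Prop :=
  {homo f : x y / x < y} \/ {homo f : x y /~ x < y}.

(* Main.v *)
From HB Require Import structures.
Require Import Defs.
From mathcomp Require Import ring lra.

(** Put [U = (F_1 (X_1), ..., F_d (X_d))] and [V = F_Y (Y)].  The copula [A] is the
distribution function of [(U, V)], and a law on the cube is known from its
distribution function, so that [mu_A] is the law of [(U, V)]
([copula_measure_rank]).  Hence [g_t = K_A (U, [0, t])] is a version of the
conditional probability of the event [V <= t] given [U] ([cond_prob_rank_cdf]),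
[psi (A) (s, t)] is the second moment [E (g_s g_t)], and everything becomes a
question about the random distribution function [g], whose mean is that of the
uniform law because [F_Y] is continuous.

Write [psi] for [psi (A)].  Expanding the square and using [E g_t = t] together
with the reflection [t |-> 1 - t] gives the integral formula and nonnegativity
([moment_gammaE]).  The function [psi] is Lipschitz because
[E |g_s - g_t| <= |s - t|], so an integral over [t] of a nonnegative combination of
its values vanishes only if that combination vanishes for every [t].

For the value 1, one has [psi (t, t) <= t] and [psi (t, 1 - t) <= min (t, 1 - t)],
and the integrals of these bounds correspond to [Q = 1]; so [Q = 1] means
[E (g_t ^ 2) = t = E g_t] for all [t] ([moment_gamma_eq1]).  As [g_t] lies in the
unit interval, this says that [g_t] is an indicator, that is, that the event
[V <= t] is determined by [U] up to a null set ([cond_prob_sqr]).  All these events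
being determined means that [V], equivalently [Y], is almost surely a measurable
function of [U], equivalently of [X] ([determined_factor]).

For the value 0, [Q = 0] means that [g_t = 1 - g_(1 - t)] almost surely for every
[t].  These are the conditional probabilities of [V <= t] and of [1 - V <= t], so
the condition says that [(U, V)] and [(U, 1 - V)] have the same law, and
[1 - V] is the rank of [- Y] ([gini_Q_eq0_same_copula]).

The invariance properties hold because conditional probabilities depend only on the
sigma-algebra of [X] completed by null sets.  It is also that of [U]
([determined_rank_tuple]): the event [X_i <= r] differs from [F_i (X_i) <= F_i (r)]
by a null set.  Neither permutations nor strictly monotone transformations of the
coordinates change it. *)

Set Implicit Arguments.
Unset Strict Implicit.
Unset Printing Implicit Defensive.

Local Open Scope classical_set_scope.
Local Open Scope ring_scope.

(** * Expectations of bounded random variables *)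

Section bounded_expectation.
Context (disp : measure_display) (T : measurableType disp) (R : realType)
  (P : probability T R).
Implicit Types (f g : T -> R) (A B : set T).

Definition bounded_mfun f :=
  measurable_fun setT f /\ exists M, forall w, `|f w| <= M.

Lemma bounded_mfun01 f : measurable_fun setT f -> (forall w, 0 <= f w <= 1) ->
  bounded_mfun f.
Proof.
by move=> mf f01; split=> //; exists 1 => w; have /andP[f0 f1] := f01 w;
  rewrite ger0_norm.
Qed.

Lemma bounded_mfun_cst (c : R) : bounded_mfun (fun=> c).
Proof. by split; [exact: measurable_cst|exists `|c|]. Qed.

Lemma bounded_mfun_indic A : measurable A -> bounded_mfun \1_A.
Proof.
move=> mA; apply: bounded_mfun01 => [|w]; first exact: measurable_indic.
by rewrite indicE; case: (_ \in _) => /=; rewrite ?lexx ?ler01.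
Qed.

Lemma bounded_mfunD f g : bounded_mfun f -> bounded_mfun g ->
  bounded_mfun (fun w => f w + g w).
Proof.
move=> [mf [M fM]] [mg [N gN]]; split; first exact: measurable_funD.
by exists (M + N) => w; rewrite (le_trans (ler_normD _ _))// lerD.
Qed.

Lemma bounded_mfunM f g : bounded_mfun f -> bounded_mfun g ->
  bounded_mfun (fun w => f w * g w).
Proof.
move=> [mf [M fM]] [mg [N gN]]; split; first exact: measurable_funM.
by exists (M * N) => w; rewrite normrM ler_pM.
Qed.

Lemma bounded_mfunN f : bounded_mfun f -> bounded_mfun (fun w => - f w).
Proof.
move=> [mf [M fM]]; split; first exact: measurable_funN.
by exists M => w; rewrite normrN.
Qed.

Lemma bounded_mfunB f g : bounded_mfun f -> bounded_mfun g ->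
  bounded_mfun (fun w => f w - g w).
Proof. by move=> bf bg; apply: bounded_mfunD => //; exact: bounded_mfunN. Qed.

Lemma bounded_mfun_abs f : bounded_mfun f -> bounded_mfun (fun w => `|f w|).
Proof.
move=> [mf [M fM]]; split; first exact: measurableT_comp.
by exists M => w; rewrite normr_id.
Qed.

Lemma bounded_mfun_integrable f : bounded_mfun f ->
  P.-integrable setT (EFin \o f).
Proof.
move=> [mf [M fM]]; apply: measurable_bounded_integrable => //.
  by rewrite (le_lt_trans (probability_le1 _ _)) ?ltry.
exists M; split; first exact: num_real.
by move=> x Mx w _ /=; exact: le_trans (fM w) (ltW Mx).
Qed.

Lemma expectD f g : bounded_mfun f -> bounded_mfun g ->
  \int[P]_w (f w + g w) = \int[P]_w f w + \int[P]_w g w.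
Proof. by move=> bf bg; apply: RintegralD => //; exact: bounded_mfun_integrable. Qed.

Lemma expectB f g : bounded_mfun f -> bounded_mfun g ->
  \int[P]_w (f w - g w) = \int[P]_w f w - \int[P]_w g w.
Proof. by move=> bf bg; apply: RintegralB => //; exact: bounded_mfun_integrable. Qed.

Lemma expectZ (c : R) f : bounded_mfun f ->
  \int[P]_w (c * f w) = c * \int[P]_w f w.
Proof. by move=> bf; apply: RintegralZl => //; exact: bounded_mfun_integrable. Qed.

Lemma expect_cst (c : R) : \int[P]_w c = c.
Proof.
rewrite Rintegral_cst//= (_ : P setT = 1%E) ?mulr1//; exact: probability_setT.
Qed.

Lemma le_expect f g : bounded_mfun f -> bounded_mfun g ->
  (forall w, f w <= g w) -> \int[P]_w f w <= \int[P]_w g w.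
Proof.
by move=> bf bg fg; apply: le_Rintegral => //; exact: bounded_mfun_integrable.
Qed.

Lemma expect_ge0 f : (forall w, 0 <= f w) -> 0 <= \int[P]_w f w.
Proof. by move=> f0; apply: Rintegral_ge0. Qed.

Lemma norm_expect f : bounded_mfun f ->
  `|\int[P]_w f w| <= \int[P]_w `|f w|.
Proof. by move=> bf; apply: le_normr_Rintegral => //; exact: bounded_mfun_integrable. Qed.

Lemma expect_indic A : measurable A -> \int[P]_w \1_A w = fine (P A).
Proof. by move=> mA; rewrite /Rintegral integral_indic// setIT. Qed.

Lemma fine_probB A B : measurable A -> measurable B ->
  fine (P (A `\` B)) = fine (P A) - fine (P (A `&` B)).
Proof.
move=> mA mB; rewrite measureD// ?fineB ?fin_num_measure//; first exact: measurableI.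
by rewrite (le_lt_trans (probability_le1 _ _)) ?ltry.
Qed.

(** A bounded variable of vanishing second moment has vanishing first absolute
moment; the bound [2 e |f| <= e^2 + f^2] replaces the Cauchy-Schwarz
inequality. *)
Lemma expect_sqr0 f : bounded_mfun f -> \int[P]_w (f w ^+ 2) = 0 ->
  \int[P]_w `|f w| = 0.
Proof.
move=> bf f0; apply/eqP; rewrite eq_le expect_ge0// andbT.
apply/ler_addgt0Pr => e e0; rewrite add0r.
have bf2 : bounded_mfun (fun w => f w ^+ 2) by exact: bounded_mfunM.
rewrite -(ler_pM2l (_ : 0 < 2 * e)) ?mulr_gt0// -expectZ; last exact: bounded_mfun_abs.
apply: (@le_trans _ _ (\int[P]_w (e ^+ 2 + f w ^+ 2))).
  apply: le_expect => [||w].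
  - by apply: bounded_mfunM; [exact: bounded_mfun_cst|exact: bounded_mfun_abs].
  - by apply: bounded_mfunD => //; exact: bounded_mfun_cst.
  - rewrite -(real_normK (num_real (f w))).
    by have := sqr_ge0 (e - `|f w|); nra.
rewrite expectD//; last exact: bounded_mfun_cst.
by rewrite expect_cst f0; nra.
Qed.

End bounded_expectation.

(** * Integrals of continuous functions over the unit interval *)

Section unit_interval.
Context (R : realType).
Local Notation mu := (@lebesgue_measure R).
Implicit Types (f g : R -> R).

Lemma continuous_integrable_itv f (a b : R) : continuous f ->
  mu.-integrable `[a, b] (EFin \o f).
Proof.
move=> cf; apply: continuous_compact_integrable; first exact: segment_compact.
exact: continuous_subspaceT.
Qed.

Lemma integral01D f g : continuous f -> continuous g ->
  \int[mu]_(t in `[0, 1]) (f t + g t) =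
  \int[mu]_(t in `[0, 1]) f t + \int[mu]_(t in `[0, 1]) g t.
Proof. by move=> cf cg; apply: RintegralD => //; exact: continuous_integrable_itv. Qed.

Lemma integral01B f g : continuous f -> continuous g ->
  \int[mu]_(t in `[0, 1]) (f t - g t) =
  \int[mu]_(t in `[0, 1]) f t - \int[mu]_(t in `[0, 1]) g t.
Proof. by move=> cf cg; apply: RintegralB => //; exact: continuous_integrable_itv. Qed.

Lemma integral01_cst (c : R) : \int[mu]_(t in `[0, 1]) c = c.
Proof.
by rewrite Rintegral_cst//= lebesgue_measure_itv/= lte_fin ltr01 oppr0 adde0/= mulr1.
Qed.

Lemma integral01_onem f : continuous f ->
  \int[mu]_(t in `[0, 1]) f (1 - t) = \int[mu]_(t in `[0, 1]) f t.
Proof.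
move=> cf; rewrite [RHS](@Rintegration_by_substitution_onem R f 1) ?ler01 ?lexx//.
  by rewrite unstable.onem1.
exact: continuous_subspaceT.
Qed.

(** A nonnegative continuous function of zero integral vanishes: a positive value
at a point bounds the integral from below by that of a constant over a short
interval around the point. *)
Lemma integral01_eq0 f : continuous f -> (forall t, 0 <= t <= 1 -> 0 <= f t) ->
  \int[mu]_(t in `[0, 1]) f t = 0 -> forall t, 0 <= t <= 1 -> f t = 0.
Proof.
move=> cf f0 If t0 t01; apply/eqP; rewrite eq_le f0// andbT leNgt; apply/negP => ft0.
have h : \forall t \near t0, f t0 / 2 < f t.
  apply: (cvgr_gt (f t0) (cf t0)).
  by rewrite ltr_pdivrMr// ltr_pMr// ltr1n.
have [e /= e0 he] := (@nbhs_ballP R R t0 _).1 h.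
pose a := Num.max 0 (t0 - e / 2); pose b := Num.min 1 (t0 + e / 2).
have ab : a < b.
  by rewrite /a /b gt_max !lt_min; apply/andP; split; apply/andP; split; lra.
have sub : `[a, b] `<=` `[0, 1].
  move=> x /=; rewrite !in_itv/= ge_max le_min.
  by move=> /andP[/andP[-> _] /andP[-> _]].
have : 0 < \int[mu]_(t in `[0, 1]) f t.
  apply: (@lt_le_trans _ _ (\int[mu]_(t in `[a, b]) (f t0 / 2))).
    rewrite Rintegral_cst//= lebesgue_measure_itv/= lte_fin ab -EFinB/=.
    by rewrite mulr_gt0 ?divr_gt0// subr_gt0.
  apply: (@le_trans _ _ (\int[mu]_(t in `[a, b]) f t)).
    apply: le_Rintegral => //.
    - by apply: (@continuous_integrable_itv (fun=> f t0 / 2)) => x; exact: cvg_cst.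
    - exact: continuous_integrable_itv.
    move=> t /=; rewrite in_itv/= ge_max le_min => /andP[/andP[_ ta] /andP[_ tb]].
    by apply/ltW/he => /=; rewrite /ball/= ltr_norml; apply/andP; split; lra.
  rewrite /Rintegral fine_le//.
  - by apply: integrable_fin_num => //; exact: continuous_integrable_itv.
  - by apply: integrable_fin_num => //; exact: continuous_integrable_itv.
  apply: ge0_subset_integral => //.
  apply/measurable_EFinP/(measurable_funS measurableT) => //.
  exact: continuous_measurable_fun.
by rewrite If ltxx.
Qed.

Lemma integral_id0 (c : R) : 0 < c -> \int[mu]_(t in `[0, c]) t = c ^+ 2 / 2.
Proof.
move=> c0; rewrite /Rintegral (@continuous_FTC2 R _ (fun x => x ^+ 2 / 2))//=.
- by rewrite expr0n/= mul0r subr0.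
- by apply: continuous_subspaceT => x; exact: cvg_id.
- have cF (x : R) : {for x, continuous (fun x : R => x ^+ 2 / 2)}.
    by apply: cvgMr_tmp; exact: exprn_continuous.
  split; [|exact/cvg_at_right_filter/cF|exact/cvg_at_left_filter/cF].
  by move=> x _; apply: derivableM => //.
- move=> x _; rewrite derive1Mr; last exact: exprn_derivable.
  by rewrite exp_derive1 /GRing.scale/=; field.
Qed.

(** The reflection [t |-> 1 - t] exchanges the two halves of the interval. *)
Lemma integral01_min : \int[mu]_(t in `[0, 1]) Num.min t (1 - t) = 1 / 4.
Proof.
have cid : continuous (fun t : R => t) by move=> x; exact: cvg_id.
have conem : continuous (fun t : R => 1 - t).
  by move=> x; apply: cvgB; [exact: cvg_cst|exact: cvg_id].
have cmin : continuous (fun t : R => Num.min t (1 - t)).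
  move=> x; apply: (continuous_min (f := fun t : R => t) (g := fun t : R => 1 - t)).
  - exact: cid.
  - exact: conem.
rewrite -(@subrK _ (\int[mu]_(t in `[0, 1 / 2]) Num.min t (1 - t)) (Rintegral _ _ _)).
rewrite Rintegral_itvB ?bnd_simp; [|exact: continuous_integrable_itv|lra|lra].
rewrite Rintegral_itv_obnd_cbnd; last first.
  apply: (integrableS _ _ _ (@continuous_integrable_itv _ 0 1 cmin)) => //.
  by move=> x /=; rewrite !in_itv/= => /andP[? ?]; apply/andP; split; lra.
have -> : \int[mu]_(t in `[0, 1 / 2]) Num.min t (1 - t) = 1 / 8.
  rewrite (@eq_Rintegral _ _ _ mu _ id); last first.
    by move=> t; rewrite inE/= in_itv/= => /andP[? ?]; apply/min_idPl; lra.
  by rewrite integral_id0; [field|lra].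
have -> : \int[mu]_(t in `[1 / 2, 1]) Num.min t (1 - t) = 1 / 8.
  rewrite (@eq_Rintegral _ _ _ mu _ (fun t => 1 - t)); last first.
    by move=> t; rewrite inE/= in_itv/= => /andP[? ?]; apply/min_idPr; lra.
  have := @Rintegration_by_substitution_onem R id (1 / 2).
  have -> : unstable.onem (1 / 2) = 1 / 2 :> R by rewrite /unstable.onem; field.
  move=> <-; [|lra|exact: continuous_subspaceT].
  by rewrite integral_id0; [field|lra].
by field.
Qed.

End unit_interval.

(** * Gini's gamma of the second moments of a random distribution function *)

(** The distribution function of the uniform law on the unit interval. *)
Definition clamp01 (R : realType) (t : R) : R := Num.min 1 (Num.max 0 t).

Lemma clamp01_id (R : realType) (t : R) : 0 <= t <= 1 -> clamp01 t = t.
Proof. by move=> /andP[t0 t1]; rewrite /clamp01 max_r// min_r. Qed.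

Lemma clamp01_lip (R : realType) (s t : R) : s <= t ->
  clamp01 t - clamp01 s <= t - s.
Proof.
move=> st; rewrite /clamp01 /Num.min /Num.max.
by do ![case: ifPn]; rewrite -?leNgt => *; lra.
Qed.

Section random_cdf.
Context (disp : measure_display) (T : measurableType disp) (R : realType)
  (P : probability T R).
Local Notation mu := (@lebesgue_measure R).

(** The value [g t w] stands for [K_A(u, [0, t])] at the point [u] of ranks that
the outcome [w] yields.  Prescribing the mean on the whole line, and not only on
the unit interval, makes the second moments Lipschitz on the whole plane. *)
Record random_cdf (g : R -> T -> R) : Prop := RandomCdf {
  random_cdf_meas : forall t, measurable_fun setT (g t) ;
  random_cdf01 : forall t w, 0 <= g t w <= 1 ;
  random_cdf_homo : forall s t w, s <= t -> g s w <= g t w ;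
  random_cdf_mean : forall t, \int[P]_w g t w = clamp01 t }.

Variables (g : R -> T -> R) (hg : random_cdf g).

(** The copula [psi (A)]. *)
Definition cdf_moment (s t : R) := \int[P]_w (g s w * g t w).
Local Notation psi := cdf_moment.

(** The inner integral of the formula for [Q]. *)
Definition asymmetry (t : R) := \int[P]_w (g t w - (1 - g (1 - t) w)) ^+ 2.

Let bg t : bounded_mfun (g t).
Proof. exact: bounded_mfun01 (random_cdf_meas hg t) (random_cdf01 hg t). Qed.

Let bgg s t : bounded_mfun (fun w => g s w * g t w).
Proof. exact: bounded_mfunM. Qed.

Lemma cdf_momentC s t : psi s t = psi t s.
Proof. by apply: eq_Rintegral => w _; rewrite mulrC. Qed.

Lemma cdf_moment_le s t s' t' : s <= s' -> t <= t' -> psi s t <= psi s' t'.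
Proof.
move=> ss tt; apply: le_expect => // w.
have /andP[? _] := random_cdf01 hg s w; have /andP[? _] := random_cdf01 hg t w.
by apply: ler_pM => //; exact: (random_cdf_homo hg).
Qed.

Lemma cdf_moment_le_mean s t : psi s t <= clamp01 s.
Proof.
rewrite -(random_cdf_mean hg); apply: le_expect => // w.
have /andP[? _] := random_cdf01 hg s w; have /andP[_ ?] := random_cdf01 hg t w.
by rewrite ler_piMr.
Qed.

Let psi_incl s s' t : s <= s' -> psi s' t - psi s t <= s' - s.
Proof.
move=> ss; apply: le_trans (clamp01_lip ss).
rewrite -!(random_cdf_mean hg) -!expectB//.
apply: le_expect => [||w]; [exact: bounded_mfunB|exact: bounded_mfunB|].
rewrite -mulrBl ler_piMr ?subr_ge0 ?(random_cdf_homo hg)//.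
by have /andP[] := random_cdf01 hg t w.
Qed.

Let psi_lipl s s' t : `|psi s t - psi s' t| <= `|s - s'|.
Proof.
wlog ss : s s' / s <= s' => [H|].
  by have [/H //|/ltW/H] := leP s s'; rewrite distrC (distrC s').
rewrite distrC (distrC s) !ger0_norm ?subr_ge0 ?cdf_moment_le//.
exact: psi_incl.
Qed.

(** The second moments inherit the Lipschitz continuity of the mean, which is the
identity on the unit interval. *)
Lemma cdf_moment_lip s t s' t' :
  `|psi s t - psi s' t'| <= `|s - s'| + `|t - t'|.
Proof.
rewrite (le_trans (ler_distD (psi s' t) _ _))// lerD//.
by rewrite (cdf_momentC s' t) (cdf_momentC s' t').
Qed.

Lemma cdf_moment_continuous (u v : R -> R) : continuous u -> continuous v ->
  continuous (fun t => psi (u t) (v t)).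
Proof.
move=> cu cv t; apply/cvgrPdist_le => e e0.
have e20 : 0 < e / 2 by rewrite divr_gt0.
have /cvgrPdist_le/(_ _ e20) hu := cu t; have /cvgrPdist_le/(_ _ e20) hv := cv t.
near=> x; rewrite (le_trans (cdf_moment_lip _ _ _ _))// (splitr e) lerD//.
- by near: x.
- by near: x.
Unshelve. all: by end_near. Qed.

Let cid : continuous (fun t : R => t). Proof. by move=> x; exact: cvg_id. Qed.
Let conem : continuous (fun t : R => 1 - t).
Proof. by move=> x; apply: cvgB; [exact: cvg_cst|exact: cvg_id]. Qed.

(** Gini's gamma of the copula [psi]. *)
Definition moment_gamma :=
  4 * (\int[mu]_(t in `[0, 1]) (psi t t + psi t (1 - t))) - 2.

(** The linear terms of the expanded square integrate to [t] and [1 - t]. *)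
Lemma asymmetryE t : 0 <= t <= 1 ->
  asymmetry t = psi t t + psi (1 - t) (1 - t) + 2 * psi t (1 - t) - 1.
Proof.
move=> t01; have t01' : 0 <= 1 - t <= 1 by lra.
have bsum : bounded_mfun (fun w => g t w * g t w + g (1 - t) w * g (1 - t) w).
  exact: bounded_mfunD.
have b2 : bounded_mfun (fun w => 2 * (g t w * g (1 - t) w)).
  by apply: bounded_mfunM => //; exact: bounded_mfun_cst.
have blin : bounded_mfun (fun w => 2 * (g t w + g (1 - t) w)).
  by apply: bounded_mfunM; [exact: bounded_mfun_cst|exact: bounded_mfunD].
have E : asymmetry t = \int[P]_w (g t w * g t w + g (1 - t) w * g (1 - t) w +
    2 * (g t w * g (1 - t) w) + (1 - 2 * (g t w + g (1 - t) w))).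
  by apply: eq_Rintegral => w _; ring.
have bc := bounded_mfun_cst T (1 : R).
rewrite E expectD; [|exact: bounded_mfunD|exact: bounded_mfunB].
rewrite expectD// expectD// expectZ// expectB// expectZ; last exact: bounded_mfunD.
rewrite expectD// !(random_cdf_mean hg) !clamp01_id// expect_cst.
by rewrite -!/(psi _ _); ring.
Qed.

Lemma asymmetry_ge0 t : 0 <= asymmetry t.
Proof. by apply: expect_ge0 => w; exact: sqr_ge0. Qed.

Let pol (t : R) := psi t t + psi (1 - t) (1 - t) + 2 * psi t (1 - t) - 1.

Let cpol : continuous pol.
Proof.
move=> t; apply: cvgB; last exact: cvg_cst.
apply: cvgD; first apply: cvgD.
- exact: (cdf_moment_continuous cid cid).
- exact: (cdf_moment_continuous conem conem).
- by apply: cvgMl_tmp; exact: (cdf_moment_continuous cid conem).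
Qed.

(** Expanding the square, the reflection [t |-> 1 - t] turns the term in
[psi (1 - t) (1 - t)] into the term in [psi t t]. *)
Lemma moment_gammaE :
  moment_gamma = 2 * \int[mu]_(t in `[0, 1]) asymmetry t.
Proof.
rewrite (@eq_Rintegral _ _ _ mu _ pol); last first.
  by move=> t; rewrite inE/= in_itv/= => /asymmetryE.
have c1 := cdf_moment_continuous cid cid.
have c2 := cdf_moment_continuous cid conem.
have c3 := cdf_moment_continuous conem conem.
have c13 : continuous (fun t => psi t t + psi (1 - t) (1 - t)).
  by move=> t; apply: cvgD; [exact: c1|exact: c3].
have c22 : continuous (fun t => 2 * psi t (1 - t)).
  by move=> t; apply: cvgMl_tmp; exact: c2.
rewrite /moment_gamma /pol integral01B; last 2 first.
- by move=> t; apply: cvgD; [exact: c13|exact: c22].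
- by move=> t; exact: cvg_cst.
rewrite !integral01D// (integral01_onem c1) integral01_cst.
rewrite (RintegralZl 2)//; last exact: continuous_integrable_itv.
by ring.
Qed.

Lemma moment_gamma_ge0 : 0 <= moment_gamma.
Proof.
rewrite moment_gammaE mulr_ge0//; apply: Rintegral_ge0 => t _.
exact: asymmetry_ge0.
Qed.

(** The integrand is a continuous function of [t], because the second moments are. *)
Lemma moment_gamma_eq0 :
  moment_gamma = 0 <-> (forall t, 0 <= t <= 1 -> asymmetry t = 0).
Proof.
rewrite moment_gammaE; split => [/eqP|a0].
  rewrite mulf_eq0 pnatr_eq0/= => /eqP I0 t t01; rewrite asymmetryE//.
  apply: (integral01_eq0 cpol) => // [s s01|].
    by rewrite /pol -asymmetryE// asymmetry_ge0.
  rewrite -[RHS]I0; apply: eq_Rintegral => s.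
  by rewrite inE/= in_itv/= => /asymmetryE.
rewrite (@eq_Rintegral _ _ _ mu _ (fun=> 0)); first by rewrite integral01_cst mulr0.
by move=> t; rewrite inE/= in_itv/= => /a0.
Qed.

Let psi_diag_le t : 0 <= t <= 1 -> psi t t <= t.
Proof. by move=> t01; rewrite (le_trans (cdf_moment_le_mean _ _))// clamp01_id. Qed.

Let psi_anti_le t : 0 <= t <= 1 -> psi t (1 - t) <= Num.min t (1 - t).
Proof.
move=> t01; have t01' : 0 <= 1 - t <= 1 by lra.
have := cdf_moment_le_mean t (1 - t); have := cdf_moment_le_mean (1 - t) t.
by rewrite (cdf_momentC (1 - t)) (clamp01_id t01) (clamp01_id t01') le_min => -> ->.
Qed.

(** Both [psi t t <= t] and [psi t (1 - t) <= min t (1 - t)] hold, and the value 1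
is what equality everywhere would give, so it forces equality.  Conversely
equality on the diagonal suffices, because [psi] is monotone in both arguments. *)
Lemma moment_gamma_eq1 :
  moment_gamma = 1 <-> (forall t, 0 <= t <= 1 -> psi t t = t).
Proof.
have cmin : continuous (fun t : R => Num.min t (1 - t)).
  move=> x; apply: (continuous_min (f := fun t : R => t) (g := fun t : R => 1 - t)).
  - exact: cid.
  - exact: conem.
have Iid : \int[mu]_(t in `[0, 1]) t = 1 / 2 :> R by rewrite integral_id0 ?expr1n.
have Imin := integral01_min R.
have c1 := cdf_moment_continuous cid cid.
have c2 := cdf_moment_continuous cid conem.
have cdef : continuous (fun t => (t - psi t t) + (Num.min t (1 - t) - psi t (1 - t))).
  by move=> t; apply: cvgD; apply: cvgB; [exact: cid|exact: c1|exact: cmin|exact: c2].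
have Q : moment_gamma = 1 - 4 * \int[mu]_(t in `[0, 1])
    ((t - psi t t) + (Num.min t (1 - t) - psi t (1 - t))).
  rewrite /moment_gamma (integral01D c1 c2).
  rewrite (@integral01D _ (fun t => t - psi t t)
    (fun t => Num.min t (1 - t) - psi t (1 - t))).
  by rewrite !integral01B// Iid Imin; field.
  - by move=> t; apply: cvgB; [exact: cid|exact: c1].
  - by move=> t; apply: cvgB; [exact: cmin|exact: c2].
rewrite Q; split => [Q1 t t01|H].
  have I0 : \int[mu]_(t in `[0, 1])
      ((t - psi t t) + (Num.min t (1 - t) - psi t (1 - t))) = 0 by lra.
  have def0 : (t - psi t t) + (Num.min t (1 - t) - psi t (1 - t)) = 0.
    apply: (integral01_eq0 cdef _ I0 t01) => s s01.
    by rewrite addr_ge0// subr_ge0 ?psi_diag_le ?psi_anti_le.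
  by have := psi_diag_le t01; have := psi_anti_le t01; lra.
rewrite (@eq_Rintegral _ _ _ mu _ (fun=> 0)); first by rewrite integral01_cst mulr0 subr0.
move=> t; rewrite inE/= in_itv/= => t01.
have t01' : 0 <= 1 - t <= 1 by lra.
rewrite H// subrr add0r; apply/eqP; rewrite eq_le subr_ge0 psi_anti_le// subr_le0 andbT.
have [tt|tt] := leP t (1 - t).
  by rewrite -{1}(H t t01); exact: cdf_moment_le.
by rewrite -{1}(H _ t01'); apply: cdf_moment_le => //; exact: ltW.
Qed.

End random_cdf.

(** * Events determined by a random element up to null sets *)

Lemma measurable_fun_rays (R : realType) d (W : measurableType d) (f : W -> R) :
  (forall r, measurable (f @^-1` `]-oo, r])) -> measurable_fun setT f.
Proof.
move=> H.
apply: (measurability _ (RGenOInfty.measurableE R)) => _ [_ [r ->] <-].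
by rewrite setTI -setCitvl preimage_setC; apply: measurableC; exact: H.
Qed.

Section determined_events.
Context (disp : measure_display) (T : measurableType disp) (R : realType)
  (P : probability T R).
Implicit Types (A B C : set T).

Definition aeq A B := P.-negligible (A `\` B) /\ P.-negligible (B `\` A).

Lemma aeq_refl A : aeq A A.
Proof. by split; rewrite setDv; exact: negligible_set0. Qed.

Lemma aeq_trans A B C : aeq A B -> aeq B C -> aeq A C.
Proof.
move=> [AB BA] [BC CB]; split.
- apply: negligibleS (negligibleU AB BC) => w [Aw nCw].
  by have [Bw|nBw] := pselect (B w); [right|left].
- apply: negligibleS (negligibleU BA CB) => w [Cw nAw].
  by have [Bw|nBw] := pselect (B w); [left|right].
Qed.

Lemma aeqC A B : aeq A B -> aeq (~` A) (~` B).
Proof. by move=> [AB BA]; split; rewrite setDE setCK setIC -setDE. Qed.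

Lemma aeq_bigcup (A B : (set T)^nat) : (forall n, aeq (A n) (B n)) ->
  aeq (\bigcup_n A n) (\bigcup_n B n).
Proof.
move=> AB; split.
- apply: negligibleS (negligible_bigcup (fun n => (AB n).1)) => w [[n _ Anw] nB].
  by exists n => //; split=> // Bnw; apply: nB; exists n.
- apply: negligibleS (negligible_bigcup (fun n => (AB n).2)) => w [[n _ Anw] nB].
  by exists n => //; split=> // Bnw; apply: nB; exists n.
Qed.

Lemma le_prob_aeq A B : measurable A -> measurable B ->
  P.-negligible (A `\` B) -> (P A <= P B)%E.
Proof.
move=> mA mB AB; rewrite -[in leLHS](setUIDK A B) measureU//=; last 3 first.
- exact: measurableI.
- exact: measurableD.
- by rewrite setDE setIACA setICr setI0.
rewrite (_ : P (A `\` B) = 0%E) ?adde0 ?le_measure ?inE//.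
- exact: measurableI.
- by apply: measure_negligible => //; exact: measurableD.
Qed.

Lemma aeq_prob A B : measurable A -> measurable B -> aeq A B -> P A = P B.
Proof.
by move=> mA mB [AB BA]; apply/eqP; rewrite eq_le !le_prob_aeq.
Qed.

Lemma aeq_probI A B D : measurable A -> measurable B -> measurable D ->
  aeq A B -> P (D `&` A) = P (D `&` B).
Proof.
move=> mA mB mD [AB BA]; apply: aeq_prob; [exact: measurableI..|split].
- by apply: negligibleS AB => w [[? ?] nDB]; split=> // ?; exact: nDB.
- by apply: negligibleS BA => w [[? ?] nDB]; split=> // ?; exact: nDB.
Qed.

Section determined_by.
Context (d' : measure_display) (U : measurableType d').

(** The completion, within the measurable events, of the sigma-algebra generated
by [Z]. *)
Definition determined (Z : T -> U) : set (set T) :=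
  [set B | measurable B /\ exists2 E, measurable E & aeq B (Z @^-1` E)].

Variable Z : T -> U.

Lemma determined_sigma_algebra : sigma_algebra setT (determined Z).
Proof.
split.
- split; first exact: measurable0.
  by exists set0 => //; rewrite preimage_set0; exact: aeq_refl.
- move=> A [mA [E mE AE]]; rewrite setTD; split; first exact: measurableC.
  by exists (~` E); [exact: measurableC|rewrite preimage_setC; exact: aeqC].
- move=> F FS; split; first by apply: bigcupT_measurable => n; have [] := FS n.
  have /choice[E hE] : forall n, exists E, measurable E /\ aeq (F n) (Z @^-1` E).
    by move=> n; have [_ [E mE aE]] := FS n; exists E.
  exists (\bigcup_n E n); first by apply: bigcupT_measurable => n; have [] := hE n.
  by rewrite preimage_bigcup; apply: aeq_bigcup => n; have [] := hE n.
Qed.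

Lemma determined_measurable B : determined Z B -> measurable B.
Proof. by case. Qed.

Lemma determined_aeq A B : determined Z A -> measurable B -> aeq B A ->
  determined Z B.
Proof.
by move=> [mA [E mE AE]] mB BA; split=> //; exists E => //; exact: aeq_trans AE.
Qed.

Lemma determined_preimage E : measurable_fun setT Z -> measurable E ->
  determined Z (Z @^-1` E).
Proof.
move=> mZ mE; split; first by rewrite -[X in measurable X]setTI; exact: mZ.
by exists E => //; exact: aeq_refl.
Qed.

End determined_by.

Definition determinedType d' (U : measurableType d') (Z : T -> U) :=
  g_sigma_algebraType (determined Z).

Lemma determined_measurableE d' (U : measurableType d') (Z : T -> U) :
  (@measurable _ (determinedType Z)) = determined Z.
Proof. exact: (measurable_g_measurableTypeE (determined_sigma_algebra Z)). Qed.

Lemma determined_funP d' (U : measurableType d') (Z : T -> U) d2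
    (V : measurableType d2) (W : T -> V) :
  measurable_fun setT (W : determinedType Z -> V) <->
  (forall E, measurable E -> determined Z (W @^-1` E)).
Proof.
split=> [mW E mE|H _ E mE].
  by have := mW measurableT E mE; rewrite setTI determined_measurableE.
by rewrite setTI determined_measurableE; exact: H.
Qed.

Lemma determined_fun_measurable d' (U : measurableType d') (Z : T -> U) d2
    (V : measurableType d2) (W : T -> V) :
  measurable_fun setT (W : determinedType Z -> V) -> measurable_fun setT W.
Proof.
move=> /determined_funP H _ E mE; rewrite setTI.
exact: determined_measurable (H E mE).
Qed.

Lemma determined_subset d' (U : measurableType d') (Z : T -> U) d2
    (V : measurableType d2) (W : T -> V) :
  measurable_fun setT (W : determinedType Z -> V) ->
  determined W `<=` determined Z.
Proof.
move=> /determined_funP H B [mB [E mE BE]].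
exact: determined_aeq (H E mE) mB BE.
Qed.

(** * Conditional probabilities given a random element *)

Section conditional_probability.
Context (d' : measure_display) (U : measurableType d') (Z : T -> U).
Implicit Types g : T -> R.

(** [g] is a version of the conditional probability of [B] given [Z].  Everything
refers to the completed sigma-algebra [determined Z], so that the notion depends
on [Z] through the information that it carries only. *)
Record cond_prob B g : Prop := CondProb {
  cond_prob_meas : measurable_fun setT (g : determinedType Z -> R) ;
  cond_prob01 : forall w, 0 <= g w <= 1 ;
  cond_prob_event : measurable B ;
  cond_probI : forall D, determined Z D ->
    \int[P]_w (g w * \1_D w) = fine (P (B `&` D)) }.

Lemma cond_prob_bounded B g : cond_prob B g -> bounded_mfun g.
Proof.
move=> [mg g01 _ _]; apply: bounded_mfun01 => //.
exact: (determined_fun_measurable mg).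
Qed.

Let determinedT : determined Z setT.
Proof.
by rewrite -determined_measurableE; exact: measurableT.
Qed.

Lemma cond_prob_mean B g : cond_prob B g -> \int[P]_w g w = fine (P B).
Proof.
move=> hg; rewrite -[in RHS](setIT B) -(cond_probI hg determinedT).
by apply: eq_Rintegral => w _; rewrite indicT mulr1.
Qed.

Lemma cond_probC B g : cond_prob B g -> cond_prob (~` B) (fun w => 1 - g w).
Proof.
move=> hg; have [mg g01 mB gI] := hg; split.
- by apply: measurable_funB => //; exact: measurable_cst.
- by move=> w; have := g01 w; lra.
- exact: measurableC.
- move=> D SD; have mD := determined_measurable SD.
  have bD := bounded_mfun_indic R mD.
  rewrite (@eq_Rintegral _ _ _ P _ (fun w => \1_D w - g w * \1_D w)); last first.
    by move=> w _; rewrite mulrBl mul1r.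
  rewrite expectB//; last by apply: bounded_mfunM => //; exact: cond_prob_bounded hg.
  by rewrite expect_indic// gI// [in RHS]setIC -setDE fine_probB// (setIC D).
Qed.

Lemma cond_prob_indic B : determined Z B -> cond_prob B \1_B.
Proof.
move=> SB; have mB := determined_measurable SB; split.
- by apply: measurable_indic; rewrite determined_measurableE.
- by move=> w; rewrite indicE; case: (_ \in _); rewrite ?lexx ?ler01.
- by [].
- move=> D SD; have mD := determined_measurable SD.
  rewrite -(expect_indic P (measurableI _ _ mB mD)).
  by apply: eq_Rintegral => w _; rewrite indicI.
Qed.

(** The event [g < h] is determined by [Z], so that [g] and [h] have the same mean on
it and on its complement. *)
Lemma cond_prob_ext B C g h : cond_prob B g -> cond_prob C h ->
  (forall D, determined Z D -> P (B `&` D) = P (C `&` D)) ->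
  \int[P]_w `|g w - h w| = 0.
Proof.
move=> hg hh BC.
have bg := cond_prob_bounded hg; have bh := cond_prob_bounded hh.
pose D := [set w | g w < h w].
have SD : determined Z D.
  rewrite -determined_measurableE -[X in measurable X]setTI.
  have := measurable_fun_ltr (cond_prob_meas hg) (cond_prob_meas hh).
  by move=> /(_ measurableT [set true] I); exact.
have mD := determined_measurable SD.
have bD : bounded_mfun (\1_D : T -> R) by exact: bounded_mfun_indic.
have bgh := bounded_mfunB bg bh.
have bgD := bounded_mfunM bg bD; have bhD := bounded_mfunM bh bD.
rewrite (@eq_Rintegral _ _ _ P _
    (fun w => (g w - h w) - 2 * (g w * \1_D w - h w * \1_D w))); last first.
  move=> w _; rewrite indicE; have [gh|gh] := ltP (g w) (h w).
    by rewrite mem_set//= ltr0_norm ?subr_lt0//; ring.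
  rewrite memNset ?ger0_norm ?subr_ge0//=; first by ring.
  by rewrite /D/= ltNge gh.
rewrite expectB//; last first.
  by apply: bounded_mfunM; [exact: bounded_mfun_cst|exact: bounded_mfunB].
rewrite expectZ ?expectB//; last exact: bounded_mfunB.
rewrite (cond_probI hg)// (cond_probI hh)// BC// (cond_prob_mean hg) (cond_prob_mean hh).
rewrite -[in X in X - _ - _](setIT B) -[in X in _ - X - _](setIT C) BC//.
by rewrite !subrr mulr0 subr0.
Qed.

(** As [g] and [h] lie in the unit interval, [(g - h) ^ 2 <= |g - h|]; conversely, a
vanishing mean square makes [|g - h|], hence the difference of the means over any
event, vanish. *)
Lemma cond_prob_L2_ext B C g h : cond_prob B g -> cond_prob C h ->
  \int[P]_w (g w - h w) ^+ 2 = 0 <->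
  (forall D, determined Z D -> P (B `&` D) = P (C `&` D)).
Proof.
move=> hg hh; have bg := cond_prob_bounded hg; have bh := cond_prob_bounded hh.
have bgh := bounded_mfunB bg bh.
split=> [gh0 D SD|BC].
  have mD := determined_measurable SD.
  have bD : bounded_mfun (\1_D : T -> R) by exact: bounded_mfun_indic.
  have {}gh0 := expect_sqr0 bgh gh0.
  have finI A : measurable A -> P (A `&` D) \is a fin_num.
    by move=> mA; rewrite fin_num_measure//; exact: measurableI.
  rewrite -(fineK (finI B (cond_prob_event hg))) -(fineK (finI C (cond_prob_event hh))).
  congr EFin; apply/eqP.
  rewrite -(cond_probI hg)// -(cond_probI hh)// -subr_eq0 -normr_le0.
  rewrite -expectB; [|exact: bounded_mfunM..].
  rewrite (le_trans (norm_expect P _))//.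
    by apply: bounded_mfunB; exact: bounded_mfunM.
  rewrite -[leRHS]gh0; apply: le_expect.
  - by apply: bounded_mfun_abs; apply: bounded_mfunB; exact: bounded_mfunM.
  - exact: bounded_mfun_abs.
  - move=> w; rewrite -mulrBl normrM ler_piMr// indicE.
    by case: (_ \in _); rewrite ?normr0 ?normr1 ?ler01.
apply/eqP; rewrite eq_le; apply/andP; split; last first.
  by apply: expect_ge0 => w; exact: sqr_ge0.
rewrite -[leRHS](cond_prob_ext hg hh BC); apply: le_expect.
- exact: bounded_mfunM.
- exact: bounded_mfun_abs.
- move=> w; rewrite -real_normK ?num_real// expr2 ler_piMr// ler_norml.
  by have := cond_prob01 hg w; have := cond_prob01 hh w; lra.
Qed.

(** Since [g] takes its values in the unit interval, [E (g ^ 2) = E g] means that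
[g] is almost surely an indicator, that of a determined event. *)
Lemma cond_prob_sqr B g : cond_prob B g ->
  \int[P]_w (g w * g w) = fine (P B) <-> determined Z B.
Proof.
move=> hg; have bg := cond_prob_bounded hg; have mB := cond_prob_event hg.
split=> [g2|SB]; last first.
  have h0 := cond_prob_ext hg (cond_prob_indic SB) (fun _ _ => erefl).
  have bB := bounded_mfun_indic R mB.
  apply/eqP; rewrite -subr_eq0 -(cond_prob_mean hg) -normr_le0 -expectB//; last first.
    exact: bounded_mfunM.
  rewrite (le_trans (norm_expect P _))//.
    by apply: bounded_mfunB => //; exact: bounded_mfunM.
  rewrite -[leRHS]h0; apply: le_expect.
  - by apply: bounded_mfun_abs; apply: bounded_mfunB => //; exact: bounded_mfunM.
  - by apply: bounded_mfun_abs; exact: bounded_mfunB.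
  - move=> w; have := cond_prob01 hg w.
    have -> : g w * g w - g w = g w * (g w - 1) by ring.
    rewrite normrM indicE; case: (w \in B) => /= g01.
      by rewrite ler_piMl// ler_norml; lra.
    by rewrite subr0 ler_piMr// ler_norml; lra.
(* On the complement of [D] one has [g <= 2 g (1 - g)], and on [D] one has
[1 - g <= 2 g (1 - g)]; the right-hand sides have mean zero. *)
pose D := [set w | 2^-1 <= g w].
have SD : determined Z D.
  rewrite -determined_measurableE -[X in measurable X]setTI.
  have := measurable_fun_ler (@measurable_cst _ _ (determinedType Z) R setT 2^-1)
    (cond_prob_meas hg).
  by move=> /(_ measurableT [set true] I); exact.
have mD := determined_measurable SD.
have bD : bounded_mfun (\1_D : T -> R) by exact: bounded_mfun_indic.
have SDC : determined Z (~` D).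
  by rewrite -determined_measurableE; apply: measurableC; rewrite determined_measurableE.
have gg0 : \int[P]_w (2 * (g w - g w * g w)) = 0.
  rewrite expectZ ?expectB ?g2 ?(cond_prob_mean hg) ?subrr ?mulr0//.
    exact: bounded_mfunM.
  by apply: bounded_mfunB => //; exact: bounded_mfunM.
have null A C h : cond_prob A h -> determined Z C ->
    (forall w, h w * \1_C w <= 2 * (g w - g w * g w)) -> P.-negligible (A `&` C).
  move=> hh SC hC; have mA := cond_prob_event hh; have mC := determined_measurable SC.
  apply/negligibleP; first exact: measurableI.
  have : fine (P (A `&` C)) <= 0.
    rewrite -(cond_probI hh)// -[leRHS]gg0; apply: le_expect => //.
    - by apply: bounded_mfunM; [exact: cond_prob_bounded hh|exact: bounded_mfun_indic].
    - apply: bounded_mfunM; first exact: bounded_mfun_cst.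
      by apply: bounded_mfunB => //; exact: bounded_mfunM.
  rewrite -lee_fin fineK ?fin_num_measure//; last exact: measurableI.
  by move=> PAC; apply/eqP; rewrite eq_le PAC measure_ge0.
apply: (determined_aeq SD mB); split.
- rewrite setDE; apply: (null _ _ g) => // w; have := cond_prob01 hg w.
  rewrite indicE; have [Dw|Dw] := pselect ((~` D) w).
    rewrite mem_set// mulr1; move: Dw; rewrite /D/= => /negP; rewrite -ltNge.
    by nra.
  by rewrite memNset// mulr0; nra.
- rewrite setDE setIC; apply: (null _ _ _ (cond_probC hg) SD) => w.
  have := cond_prob01 hg w; rewrite indicE; have [Dw|Dw] := pselect (D w).
    by rewrite mem_set// mulr1; move: Dw; rewrite /D/=; nra.
  by rewrite memNset// mulr0; nra.
Qed.

End conditional_probability.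

End determined_events.

(** * Probability measures on tuples and their distribution functions *)

Section tuple_measures.
Context (R : realType) (k : nat).
Implicit Types (u : k.-tuple R) (mu nu : probability (k.-tuple R) R).

Lemma measurable_box (D : 'I_k -> set R) : (forall i, measurable (D i)) ->
  measurable [set v : k.-tuple R | forall i, D i (tnth v i)].
Proof.
move=> mD.
rewrite (_ : mkset _ = \bigcap_i ((fun v : k.-tuple R => tnth v i) @^-1` D i)).
  apply: fin_bigcap_measurable => // i _; rewrite -[X in measurable X]setTI.
  exact: measurable_tnth.
by apply/seteqP; split=> [v Dv i _|v Dv i]; [exact: Dv|exact: (Dv i I)].
Qed.

Lemma measurable_orthant u : measurable (orthant u).
Proof.
have := @measurable_box (fun i => `]-oo, tnth u i]%classic) (fun=> measurable_itv _).
by congr measurable; apply/seteqP; split=> v h i; have := h i; rewrite /= in_itv.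
Qed.

Lemma measurable_cube : measurable (@cube R k).
Proof.
have := @measurable_box (fun i => `[0, 1]%classic) (fun=> measurable_itv _).
by congr measurable; apply/seteqP; split=> v h i; have := h i; rewrite /= in_itv.
Qed.

Let orthants : set (set (k.-tuple R)) := [set orthant u | u in setT].

Let big (n : nat) : k.-tuple R := [tuple n%:R | i < k].

Let setI_orthants : setI_closed orthants.
Proof.
move=> _ _ [u _ <-] [v _ <-]; exists [tuple Num.min (tnth u i) (tnth v i) | i < k] => //.
apply/seteqP; split=> [w h|w [hu hv] i].
  by split=> i; have := h i; rewrite tnth_mktuple le_min => /andP[].
by rewrite tnth_mktuple le_min hu hv.
Qed.

Let tuple_ub u : exists N, forall n, (N <= n)%N -> forall i, tnth u i <= n%:R.
Proof.
exists (\max_(i < k) Num.truncn (tnth u i)).+1 => n hn i.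
apply/ltW/(lt_le_trans (truncnS_gt (tnth u i))); rewrite ler_nat.
by apply: leq_trans hn; rewrite ltnS; exact: (leq_bigmax i).
Qed.

(** The rays of each coordinate are increasing unions of orthants. *)
Let generated_by_orthants : @measurable _ (k.-tuple R) = <<s orthants >>.
Proof.
apply/seteqP; split=> [E mE|]; last first.
  apply: smallest_sub; first exact: sigma_algebra_measurable.
  by move=> _ [u _ <-]; exact: measurable_orthant.
have mid : measurable_fun setT (idfun : g_sigma_algebraType orthants -> k.-tuple R).
  apply/measurable_fun_tnthP => i; apply: measurable_fun_rays => r.
  rewrite (_ : _ @^-1` _ = \bigcup_n orthant
      [tuple if j == i then r else n%:R | j < k]).
    by apply: bigcupT_measurable => n; apply: sub_sigma_algebra; eexists.
  apply/seteqP; split=> [u|u [n _ /(_ i)]] /=; rewrite in_itv/=; last first.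
    by rewrite tnth_mktuple eqxx.
  move=> ur; have [N hN] := tuple_ub u; exists N => // j.
  by rewrite tnth_mktuple; case: eqP => [->//|_]; exact: hN.
by have := mid measurableT E mE; rewrite setTI.
Qed.

(** Orthants are stable under intersection and generate the sigma-algebra. *)
Lemma orthant_measure_unique mu nu :
  (forall u, mu (orthant u) = nu (orthant u)) ->
  forall E, measurable E -> mu E = nu E.
Proof.
move=> munu E mE.
apply: (measure_unique orthants (fun n => orthant (big n))) => //.
- by move=> n; exists (big n).
- apply/seteqP; split=> // u _; have [N hN] := tuple_ub u; exists N => // i.
  by rewrite tnth_mktuple hN.
- by move=> _ [u _ <-]; exact: munu.
- move=> n; rewrite (le_lt_trans (probability_le1 _ _)) ?ltry//.
  exact: measurable_orthant.
Qed.

(** A measure carried by the cube does not see the part of an orthant outside it, so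
its values on all orthants come from those of [C] on the cube. *)
Lemma is_measure_of_orthant (C : k.-tuple R -> R) mu u : is_measure_of C mu ->
  mu (orthant u) = if [forall i, 0 <= tnth u i]
    then (C [tuple Num.min (tnth u i) 1 | i < k])%:E else 0%E.
Proof.
move=> [mu1 muC].
have muI E : measurable E -> mu E = mu (E `&` @cube R k).
  move=> mE; have mc := measurable_cube.
  apply/aeq_prob => //; first exact: measurableI.
  split; last first.
    rewrite (_ : _ `\` _ = set0); first exact: negligible_set0.
    by apply/seteqP; split=> // v [[]].
  apply: (@negligibleS _ _ _ mu (~` @cube R k)).
    by move=> v [Ev nEc] cv; apply: nEc.
  apply/negligibleP; first exact: measurableC.
  have /= -> := probability_setC mu mc.
  by rewrite mu1 subee.
have mo := measurable_orthant.
rewrite muI//; case: ifPn => [/forallP u0|].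
  rewrite -muC; last first.
    by move=> i; rewrite tnth_mktuple ge_min lexx orbT le_min u0 ler01.
  rewrite [RHS]muI//; congr (mu _); apply/seteqP; split=> v [vo vc]; split=> // i.
    by rewrite tnth_mktuple le_min vo; have /andP[] := vc i.
  by have := vo i; rewrite tnth_mktuple le_min => /andP[].
rewrite negb_forall => /existsP[i]; rewrite -ltNge => ui.
rewrite (_ : _ `&` _ = set0) ?measure0//; apply/seteqP; split=> // v [vo vc].
by have := vo i; have /andP[v0 _] := vc i; rewrite leNgt (lt_le_trans ui).
Qed.

Lemma copula_measureE (C : k.-tuple R -> R) mu : is_measure_of C mu ->
  forall E, measurable E -> copula_measure C E = mu E.
Proof.
move=> hmu E mE; rewrite /copula_measure; case: pselect => [h|]; last by case; exists mu.
apply: orthant_measure_unique => // u.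
by rewrite !(is_measure_of_orthant u (C := C))//; exact: (projT2 (cid h)).
Qed.

End tuple_measures.

(** * The probability integral transform *)

Section rank_transform.
Context (disp : measure_display) (T : measurableType disp) (R : realType)
  (P : probability T R).
Implicit Types (Y : {RV P >-> R}).

(** The value 0 off the range of the coding is itself rational, hence harmless. *)
Definition enum_rat (n : nat) : R :=
  if unpickle n is Some q then ratr (q : rat) else 0.

Lemma enum_rat_dense (x y : R) : x < y -> exists n, x < enum_rat n < y.
Proof.
move=> /rat_in_itvoo[q]; rewrite in_itv/= => q_in.
by exists (pickle q); rewrite /enum_rat pickleK.
Qed.

Definition rank_transform Y : T -> R := fun w => distr_fun Y (Y w).

Lemma measurable_RV_le Y (r : R) : measurable [set w | Y w <= r].
Proof.
rewrite (_ : mkset _ = Y @^-1` `]-oo, r]); last first.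
  by apply/seteqP; split=> w /=; rewrite in_itv.
by rewrite -[X in measurable X]setTI; exact: measurable_funP.
Qed.

Lemma distr_funE Y r : distr_fun Y r = fine (P [set w | Y w <= r]).
Proof. by congr (fine (P _)); apply/seteqP; split=> w /=; rewrite in_itv. Qed.

Lemma distr_fun_ge0 Y r : 0 <= distr_fun Y r.
Proof. by rewrite fine_ge0. Qed.

Lemma distr_fun_le1 Y r : distr_fun Y r <= 1.
Proof.
by rewrite /distr_fun -lee_fin fineK ?cdf_le1// fin_num_measure.
Qed.

Lemma distr_fun_homo Y r s : r <= s -> distr_fun Y r <= distr_fun Y s.
Proof.
by move=> rs; rewrite /distr_fun fine_le ?fin_num_measure//; exact: cdf_nondecreasing.
Qed.

Lemma measurable_distr_fun Y : measurable_fun setT (distr_fun Y).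
Proof.
by apply: nondecreasing_measurable => // r s; exact: distr_fun_homo.
Qed.

Lemma measurable_rank_transform Y : measurable_fun setT (rank_transform Y).
Proof. exact: measurableT_comp (measurable_distr_fun Y) _. Qed.

HB.instance Definition _ Y := @isMeasurableFun.Build _ _ T R
  (rank_transform Y) (measurable_rank_transform Y).

Lemma rank_transform01 Y w : 0 <= rank_transform Y w <= 1.
Proof. by rewrite distr_fun_ge0 distr_fun_le1. Qed.

(** The two events differ by [Y] lying in an interval, to the right of [r], on
which the distribution function is constant.  That interval is covered by
countably many null intervals ending at rational points, unless it has a maximum, in
which case one null interval ending there suffices. *)
Lemma rank_transform_le Y r :
  aeq P [set w | Y w <= r] [set w | rank_transform Y w <= distr_fun Y r].
Proof.
split.
  rewrite (_ : _ `\` _ = set0); first exact: negligible_set0.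
  by apply/seteqP; split=> // w /= [Yr]; apply; exact: distr_fun_homo.
have null x : distr_fun Y x <= distr_fun Y r ->
    P.-negligible ([set w | Y w <= x] `\` [set w | Y w <= r]).
  move=> xr; apply/negligibleP; first by apply: measurableD; exact: measurable_RV_le.
  have mD := measurableD (measurable_RV_le Y x) (measurable_RV_le Y r).
  apply/eqP; rewrite eq_le measure_ge0 andbT -(fineK (fin_num_measure P _ mD)) lee_fin.
  have [rx|/ltW rx] := leP r x.
    rewrite fine_probB; [|exact: measurable_RV_le..].
    rewrite (_ : _ `&` _ = [set w | Y w <= r]) -?distr_funE ?subr_le0//.
    by apply/seteqP; split=> [w []//|w /= wr]; split=> //=; exact: le_trans rx.
  rewrite (_ : _ `\` _ = set0); first by have /= -> := measure0 P.
  by apply/seteqP; split=> // w /= [wx]; apply; exact: le_trans rx.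
set N := _ `\` _.
have [[w0 [[Fw0 nw0] Nw0]]|noMax] :=
  pselect (exists w0, N w0 /\ forall w, N w -> Y w <= Y w0).
  by apply: negligibleS (null _ Fw0) => w Nw; split; [exact: Nw0|case: Nw].
apply: (@negligibleS _ _ _ P (\bigcup_n (if distr_fun Y (enum_rat n) <= distr_fun Y r
    then [set w | Y w <= enum_rat n] `\` [set w | Y w <= r] else set0))); last first.
  apply: negligible_bigcup => n; case: ifPn => [/null//|_]; exact: negligible_set0.
move=> w Nw; have /existsNP[w' /not_implyP[Nw' /negP]] : ~ forall w', N w' -> Y w' <= Y w.
  by move=> Nmax; apply: noMax; exists w.
rewrite -ltNge => /enum_rat_dense[n /andP[wn nw']]; exists n => //.
rewrite ifT; last by rewrite (le_trans (distr_fun_homo Y (ltW nw')))//; case: Nw'.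
by split; [exact: ltW|case: Nw].
Qed.

(** Passing to the rank loses no information, although the distribution function need
not be injective: [Y <= r] and [F (Y) <= F (r)] differ by a null set only. *)
Lemma determined_rank d' (U : measurableType d') (Z : T -> U) Y :
  measurable_fun setT ((Y : T -> R) : determinedType P Z -> R) <->
  measurable_fun setT (rank_transform Y : determinedType P Z -> R).
Proof.
split=> [mY|/determined_funP mV].
  exact: measurableT_comp (measurable_distr_fun Y) mY.
apply: measurable_fun_rays => r; rewrite determined_measurableE.
rewrite (_ : _ @^-1` _ = [set w | Y w <= r]); last first.
  by apply/seteqP; split=> w /=; rewrite in_itv.
apply: determined_aeq (rank_transform_le Y r); last exact: measurable_RV_le.
have := mV `]-oo, distr_fun Y r]%classic (measurable_itv _).
by congr determined; apply/seteqP; split=> w /=; rewrite in_itv.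
Qed.

(** [P (F (Y) <= F (r)) = F (r)], and a continuous [F] takes every value of the
open unit interval. *)
Lemma rank_transform_uniform Y (t : R) : continuous (distr_fun Y) ->
  fine (P [set w | rank_transform Y w <= t]) = clamp01 t.
Proof.
move=> cF; pose V : {RV P >-> R} := rank_transform Y.
have mV s : measurable [set w | rank_transform Y w <= s] := measurable_RV_le V s.
have homo s s' : s <= s' -> fine (P [set w | rank_transform Y w <= s]) <=
    fine (P [set w | rank_transform Y w <= s']).
  move=> ss; rewrite fine_le ?fin_num_measure// le_measure ?inE//.
  by move=> w /= /le_trans; apply.
have in01 s : 0 < s < 1 -> fine (P [set w | rank_transform Y w <= s]) = s.
  move=> /andP[s0 s1].
  have [a Fa] : exists a, distr_fun Y a < s.
    have /fine_cvgP[_ /cvgr_lt/(_ _ s0)] := cvg_cdfNy0 Y.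
    by move=> [a [_ ha]]; exists (a - 1); apply: ha; rewrite ltrBlDr ltrDl.
  have [b Fb] : exists b, s < distr_fun Y b.
    have /fine_cvgP[_ /cvgr_gt/(_ _ s1)] := cvg_cdfy1 Y.
    by move=> [b [_ hb]]; exists (b + 1); apply: hb; rewrite ltrDl.
  have ab : a <= b.
    by rewrite leNgt; apply/negP => /ltW/(distr_fun_homo Y); rewrite leNgt (lt_trans Fa).
  have [|r _ <-] := @IVT _ (distr_fun Y) a b s ab (continuous_subspaceT cF).
    by rewrite ge_min le_max (ltW Fa) (ltW Fb) orbT.
  rewrite [in RHS]distr_funE; congr fine; apply/esym/aeq_prob => //.
  - exact: measurable_RV_le.
  - exact: rank_transform_le.
have [t0|t0] := leP t 0.
  rewrite /clamp01 max_l// min_r//; apply/eqP; rewrite eq_le fine_ge0// andbT.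
  apply/ler_addgt0Pr => e e0; rewrite add0r.
  have m0 : 0 < Num.min e 2^-1 by rewrite lt_min e0 invr_gt0 ltr0n.
  rewrite (le_trans (homo _ (Num.min e 2^-1) _)) ?(le_trans t0 (ltW m0))//.
  by rewrite in01 ?ge_min ?lexx// m0/= gt_min invf_lt1 ?ltr1n ?orbT.
have [t1|t1] := ltP t 1; first by rewrite in01 ?clamp01_id ?t0 ?t1 ?ltW.
rewrite /clamp01 max_r ?ltW// min_l// (_ : mkset _ = setT).
  by rewrite (_ : P setT = 1%E)//; exact: probability_setT.
by apply/seteqP; split=> // w _ /=; rewrite (le_trans _ t1)// distr_fun_le1.
Qed.

(** The uniform law gives mass at most [e] to the interval from [t - e] to [t]. *)
Lemma rank_transform_atomless Y (t : R) : continuous (distr_fun Y) ->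
  P.-negligible [set w | rank_transform Y w = t].
Proof.
move=> cF; pose V : {RV P >-> R} := rank_transform Y.
have mV s : measurable [set w | rank_transform Y w <= s] := measurable_RV_le V s.
have mE : measurable [set w | rank_transform Y w = t].
  rewrite -[X in measurable X]setTI.
  exact: (measurable_funP V measurableT _ (measurable_set1 t)).
apply/negligibleP => //; apply/eqP; rewrite eq_le measure_ge0 andbT.
rewrite -(fineK (fin_num_measure P _ mE)) lee_fin.
apply/ler_addgt0Pr => e e0; rewrite add0r.
have mD := measurableD (mV t) (mV (t - e)).
apply: (@le_trans _ _ (fine (P ([set w | rank_transform Y w <= t] `\`
    [set w | rank_transform Y w <= t - e])))).
  rewrite fine_le ?fin_num_measure// le_measure ?inE// => w /= ->.
  by split=> //; apply/negP; rewrite -ltNge; lra.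
rewrite fine_probB// (_ : _ `&` _ = [set w | rank_transform Y w <= t - e]); last first.
  by apply/seteqP; split=> [w []//|w /= h]; split=> //=; lra.
rewrite !rank_transform_uniform//.
by rewrite (le_trans (clamp01_lip _))//; lra.
Qed.

Lemma determined_rank_events d' (U : measurableType d') (Z : T -> U) Y :
  measurable_fun setT (rank_transform Y : determinedType P Z -> R) <->
  (forall t, 0 <= t <= 1 -> determined P Z [set w | rank_transform Y w <= t]).
Proof.
have rayE t : [set w | rank_transform Y w <= t] = rank_transform Y @^-1` `]-oo, t].
  by apply/seteqP; split=> w /=; rewrite in_itv.
split=> [/determined_funP mV t _|H]; first by rewrite rayE; exact: mV.
apply: measurable_fun_rays => t; rewrite -rayE.
have [t0|t0] := leP 0 t.
  have [t1|t1] := leP t 1; first by rewrite determined_measurableE; apply: H; rewrite t0.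
  rewrite (_ : mkset _ = setT) ?measurableT//; apply/seteqP; split=> // w _ /=.
  by rewrite (le_trans _ (ltW t1))// distr_fun_le1.
rewrite (_ : mkset _ = set0) ?measurable0//; apply/seteqP; split=> // w /=.
by rewrite leNgt (lt_le_trans t0)// distr_fun_ge0.
Qed.

End rank_transform.

(** * Random variables that are functions of a random element *)

Section factorization.
Context (disp : measure_display) (T : measurableType disp) (R : realType)
  (P : probability T R) (d' : measure_display) (U : measurableType d').
Variables (Z : T -> U) (Y : {RV P >-> R}).
Hypothesis mZ : measurable_fun setT Z.

(** From events [E n] with [Y <= q n] almost the same as [Z] in [E n], for [q]
enumerating the rationals, the factor is the infimum of the [q n] over the [n]
such that the argument lies in [E n]. *)
Lemma determined_factor :
  measurable_fun setT ((Y : T -> R) : determinedType P Z -> R) <->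
  (exists f : U -> R, measurable_fun setT f /\ P [set w | Y w = f (Z w)] = 1%E).
Proof.
have mYf (f : U -> R) : measurable_fun setT f -> measurable [set w | Y w = f (Z w)].
  move=> mf; have := measurable_fun_eqr (measurable_funP Y) (measurableT_comp mf mZ).
  move=> /(_ measurableT [set true] I); rewrite setTI; congr measurable.
  by apply/seteqP; split=> w /= /eqP.
split=> [/determined_funP mY|[f [mf Yf]]]; last first.
  have nYf : P.-negligible (~` [set w | Y w = f (Z w)]).
    apply/negligibleP; first by apply: measurableC; exact: mYf.
    have /= -> := probability_setC P (mYf f mf).
    by rewrite Yf subee.
  apply: measurable_fun_rays => r; rewrite determined_measurableE; split.
    by rewrite -[X in measurable X]setTI; exact: measurable_funP.
  exists (f @^-1` `]-oo, r]); first by rewrite -[X in measurable X]setTI; exact: mf.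
  split; apply: negligibleS nYf => w /=; rewrite !in_itv/= => -[h1 h2] Yw; apply: h2.
    by rewrite -Yw.
  by rewrite Yw.
have /choice[E hE] n : exists E, measurable E /\
    aeq P (Y @^-1` `]-oo, enum_rat R n]) (Z @^-1` E).
  by have [_ [E mE aE]] := mY _ (measurable_itv `]-oo, enum_rat R n]); exists E.
pose h n (u : U) : \bar R := if u \in E n then (enum_rat R n)%:E else +oo%E.
have mh n : measurable_fun setT (h n).
  apply: measurable_fun_ifT; [|exact: measurable_cst|exact: measurable_cst].
  by apply: (measurable_fun_bool true); rewrite setTI preimage_mem_true; have [] := hE n.
pose f u := fine (einfs (h ^~ u) 0).
have mf : measurable_fun setT f.
  by apply: measurableT_comp => //; exact: measurable_fun_einfs.
exists f; split=> //.
pose N := \bigcup_n ((Y @^-1` `]-oo, enum_rat R n] `\` Z @^-1` E n) `|`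
  (Z @^-1` E n `\` Y @^-1` `]-oo, enum_rat R n])).
have nN : P.-negligible N.
  by apply: negligible_bigcup => n; have [_ [? ?]] := hE n; exact: negligibleU.
have : P.-negligible (~` [set w | Y w = f (Z w)]).
  apply: negligibleS nN => w; apply: contra_notP => nNw /=.
  have YE n : Y w <= enum_rat R n <-> E n (Z w).
    split=> [Yn|En]; apply: contrapT => H; apply: nNw; exists n => //; [left|right].
      by split=> //=; rewrite in_itv.
    by split=> //=; rewrite in_itv.
  rewrite /f (_ : einfs _ 0 = (Y w)%:E)//; apply/eqP; rewrite eq_le; apply/andP; split.
    apply/lee_addgt0Pr => e e0.
    have /enum_rat_dense[n /andP[Yn nY]] : Y w < Y w + e by rewrite ltrDl.
    apply: (@le_trans _ _ (enum_rat R n)%:E); last by rewrite -EFinD lee_fin ltW.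
    apply: ereal_inf_lbound; exists n => //=; rewrite /h mem_set//; apply/YE; exact: ltW.
  apply: le_ereal_inf_tmp => _ [n _ <-]; rewrite /h; case: ifPn => [|_]; last exact: leey.
  by rewrite inE => /YE; rewrite lee_fin.
move=> /negligibleP-/(_ (measurableC (mYf _ mf))) nY.
have : (1 - P [set w | Y w = f (Z w)] = 0)%E.
  by rewrite -(probability_setC P (mYf f mf)); exact: nY.
rewrite -(fineK (fin_num_measure P _ (mYf f mf))) -EFinB => -[] /eqP.
by rewrite subr_eq0 => /eqP <-.
Qed.

End factorization.

(** * The copula of a random vector as the law of its rank transforms *)

Section rank_tuple.
Context (disp : measure_display) (T : measurableType disp) (R : realType)
  (P : probability T R).

Definition rank_tuple k (Z : 'I_k -> {RV P >-> R}) : T -> k.-tuple R :=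
  fun w => [tuple rank_transform (Z i) w | i < k].

Lemma measurable_tuple_fun k (f : 'I_k -> T -> R) :
  (forall i, measurable_fun setT (f i)) ->
  measurable_fun setT (fun w => [tuple f i w | i < k]).
Proof.
move=> mf; apply/measurable_fun_tnthP => i; apply: eq_measurable_fun (mf i) => w _.
by rewrite /= tnth_mktuple.
Qed.

Lemma measurable_rank_tuple k (Z : 'I_k -> {RV P >-> R}) :
  measurable_fun setT (rank_tuple Z).
Proof. by apply: measurable_tuple_fun => i; exact: measurable_rank_transform. Qed.

HB.instance Definition _ k (Z : 'I_k -> {RV P >-> R}) :=
  @isMeasurableFun.Build _ _ T (k.-tuple R) (rank_tuple Z) (measurable_rank_tuple Z).

Lemma measurable_rank_preimage k (Z : 'I_k -> {RV P >-> R}) E : measurable E ->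
  measurable (rank_tuple Z @^-1` E).
Proof.
by move=> mE; rewrite -[X in measurable X]setTI; exact: measurable_rank_tuple.
Qed.

Lemma measurable_vec k (Z : 'I_k -> {RV P >-> R}) : measurable_fun setT (vec Z).
Proof. by apply: measurable_tuple_fun => i; exact: measurable_funP. Qed.

Lemma rank_tuple_cube k (Z : 'I_k -> {RV P >-> R}) w : cube (rank_tuple Z w).
Proof. by move=> i; rewrite tnth_mktuple rank_transform01. Qed.

Lemma rank_tuple_orthant k (Z : 'I_k -> {RV P >-> R}) u :
  rank_tuple Z @^-1` orthant u =
  [set w | forall i, rank_transform (Z i) w <= tnth u i].
Proof.
by apply/seteqP; split=> w h i; have := h i; rewrite tnth_mktuple.
Qed.

Lemma connecting_copulaE k (Z : 'I_k -> {RV P >-> R}) u :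
  connecting_copula Z u = fine (P (rank_tuple Z @^-1` orthant u)).
Proof. by rewrite rank_tuple_orthant. Qed.

Lemma connecting_copula_law k (Z : 'I_k -> {RV P >-> R}) :
  is_measure_of (connecting_copula Z) (distribution P (rank_tuple Z)).
Proof.
split=> [|u _].
  rewrite /= /distribution /pushforward (_ : _ @^-1` _ = setT).
    exact: probability_setT.
  by apply/seteqP; split=> // w _; exact: rank_tuple_cube.
rewrite connecting_copulaE fineK// fin_num_measure//.
exact: measurable_rank_preimage (measurable_orthant u).
Qed.

Lemma copula_measure_rank k (Z : 'I_k -> {RV P >-> R}) E : measurable E ->
  copula_measure (connecting_copula Z) E = P (rank_tuple Z @^-1` E).
Proof. exact: copula_measureE (connecting_copula_law Z) E. Qed.

Lemma ge0_integral_copula k (Z : 'I_k -> {RV P >-> R}) E (f : k.-tuple R -> \bar R) :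
  measurable E -> measurable_fun setT f -> (forall u, 0 <= f u)%E ->
  (\int[copula_measure (connecting_copula Z)]_(u in E) f u =
   \int[P]_(w in rank_tuple Z @^-1` E) f (rank_tuple Z w))%E.
Proof.
move=> mE mf f0.
rewrite (eq_measure_integral (distribution P (rank_tuple Z))); last first.
  by move=> A mA _; exact: copula_measure_rank.
rewrite ge0_integral_pushforward//.
exact: measurable_funTS.
Qed.

Lemma integral_copula k (Z : 'I_k -> {RV P >-> R}) (f : k.-tuple R -> R) :
  measurable_fun setT f -> (forall u, 0 <= f u) ->
  \int[copula_measure (connecting_copula Z)]_(u in @cube R k) f u =
  \int[P]_w f (rank_tuple Z w).
Proof.
move=> mf f0; congr fine; rewrite ge0_integral_copula//=.
- rewrite (_ : _ @^-1` _ = setT)//.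
  by apply/seteqP; split=> // w _; exact: rank_tuple_cube.
- exact: measurable_cube.
- exact/measurable_EFinP.
Qed.

Lemma determined_coord k (Z : 'I_k -> {RV P >-> R}) i :
  measurable_fun setT ((Z i : T -> R) : determinedType P (vec Z) -> R).
Proof.
apply/determined_funP => E mE.
have := determined_preimage P (measurable_vec Z) (measurable_tnth i measurableT mE).
rewrite setTI; congr determined.
by apply/seteqP; split=> w /=; rewrite tnth_mktuple.
Qed.

Lemma determined_vec_subset k (Z : 'I_k -> {RV P >-> R}) d' (U : measurableType d')
    (W : T -> U) :
  (forall i, measurable_fun setT ((Z i : T -> R) : determinedType P W -> R)) ->
  determined P (vec Z) `<=` determined P W.
Proof.
move=> mZ; apply: determined_subset; apply/measurable_fun_tnthP => i.
by apply: eq_measurable_fun (mZ i) => w _; rewrite /= tnth_mktuple.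
Qed.

(** The ranks are functions of the coordinates, and each ray of a coordinate is a ray
of its rank up to a null set. *)
Lemma determined_rank_tuple k (Z : 'I_k -> {RV P >-> R}) :
  determined P (rank_tuple Z) = determined P (vec Z).
Proof.
have -> : rank_tuple Z = vec (fun i => rank_transform (Z i) : {RV P >-> R}) by [].
apply/seteqP; split; apply: determined_vec_subset => i.
  have := determined_coord (Z := Z) i; exact: (determined_rank _ _).1.
have := determined_coord (Z := fun i => rank_transform (Z i) : {RV P >-> R}) i.
exact: (determined_rank _ _).2.
Qed.

End rank_tuple.

Section conditional_versions.
Context (disp : measure_display) (T : measurableType disp) (R : realType)
  (P : probability T R).

(** Every determined event differs from a preimage by a null set, which does not
affect the integrals. *)
Lemma cond_prob_preimage d' (U : measurableType d') (Z : T -> U) B (g : T -> R) :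
  measurable_fun setT Z ->
  measurable_fun setT (g : determinedType P Z -> R) ->
  (forall w, 0 <= g w <= 1) -> measurable B ->
  (forall E, measurable E ->
    \int[P]_w (g w * \1_(Z @^-1` E) w) = fine (P (B `&` Z @^-1` E))) ->
  cond_prob P Z B g.
Proof.
move=> mZ mg g01 mB gE; split=> // D [mD [E mE DE]].
have mZE : measurable (Z @^-1` E) by rewrite -[X in measurable X]setTI; exact: mZ.
rewrite (aeq_probI mD mZE mB DE) -gE//.
have mgT := determined_fun_measurable mg.
have mgI A : measurable A -> measurable_fun setT (fun w => (g w * \1_A w)%:E).
  move=> mA; apply/measurable_EFinP; apply: measurable_funM; first exact: mgT.
  exact: measurable_indic.
congr fine; apply: ae_eq_integral => //; [exact: mgI|exact: mgI|].
case: DE => n1 n2; apply: negligibleS (negligibleU n1 n2) => w /=.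
apply: contra_notP => nw _; congr (_ * _)%:E; rewrite !indicE; congr (_%:R).
congr (nat_of_bool _).
by apply/idP/idP; rewrite !inE => H; apply: contrapT => H'; apply: nw; [left|right].
Qed.

Lemma cond_prob_determined d1 (U : measurableType d1) (Z : T -> U)
    d2 (V : measurableType d2) (W : T -> V) B (g : T -> R) :
  determined P Z = determined P W -> cond_prob P Z B g -> cond_prob P W B g.
Proof.
move=> ZW [/determined_funP mg g01 mB gI]; split=> //; last by rewrite -ZW.
by apply/determined_funP => E mE; rewrite -ZW; exact: mg.
Qed.

(** By uniqueness of conditional probabilities [|g_t - h_t|] has mean zero for every
[t], and [|g_s g_t - h_s h_t| <= |g_s - h_s| + |g_t - h_t|]. *)
Lemma moment_gamma_ext d1 (U : measurableType d1) (Z : T -> U)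
    d2 (V : measurableType d2) (W : T -> V) (B : R -> set T) (g h : R -> T -> R) :
  determined P Z = determined P W ->
  (forall t, cond_prob P Z (B t) (g t)) -> (forall t, cond_prob P W (B t) (h t)) ->
  moment_gamma P g = moment_gamma P h.
Proof.
move=> ZW hg hh.
have {}hh t := cond_prob_determined (esym ZW) (hh t).
have bg t := cond_prob_bounded (hg t); have bh t := cond_prob_bounded (hh t).
have gh t := cond_prob_ext (hg t) (hh t) (fun _ _ => erefl).
suff E s t : cdf_moment P g s t = cdf_moment P h s t.
  by congr (4 * _ - 2); apply: eq_Rintegral => t _; rewrite !E.
apply/eqP; rewrite -subr_eq0 -normr_le0 -expectB; [|exact: bounded_mfunM..].
have bgh r : bounded_mfun (fun w => `|g r w - h r w|).
  by apply: bounded_mfun_abs; exact: bounded_mfunB.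
rewrite (le_trans (norm_expect P _))//.
  by apply: bounded_mfunB; exact: bounded_mfunM.
rewrite (_ : 0 = \int[P]_w (`|g s w - h s w| + `|g t w - h t w|)); last first.
  by rewrite expectD// !gh addr0.
apply: le_expect => [||w].
- by apply: bounded_mfun_abs; apply: bounded_mfunB; exact: bounded_mfunM.
- exact: bounded_mfunD.
rewrite (_ : _ - _ = g t w * (g s w - h s w) + h s w * (g t w - h t w)); last by ring.
have /andP[? ?] := cond_prob01 (hg t) w; have /andP[? ?] := cond_prob01 (hh s) w.
rewrite (le_trans (ler_normD _ _))// !normrM lerD// ler_piMl// ger0_norm//.
Qed.

End conditional_versions.

(** * Markov kernels of copulas as conditional distributions of ranks *)

Section copula_kernel.
Context (disp : measure_display) (T : measurableType disp) (R : realType)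
  (P : probability T R) (d : nat).
Variables (X : 'I_d -> {RV P >-> R}) (Y : {RV P >-> R}).

Lemma widen_lift_max (i : 'I_d) : widen_ord (leqnSn d) i = lift ord_max i.
Proof. by apply/val_inj; rewrite /= /bump leqNgt ltn_ord. Qed.

Lemma join_last_widen (i : 'I_d) : join_last X Y (widen_ord (leqnSn d) i) = X i.
Proof.
by rewrite widen_lift_max /join_last liftK.
Qed.

Lemma join_last_max : join_last X Y ord_max = Y.
Proof. by rewrite /join_last unlift_none. Qed.

Lemma tuple_init_rank w : tuple_init (rank_tuple (join_last X Y) w) = rank_tuple X w.
Proof. by apply: eq_from_tnth => i; rewrite !tnth_mktuple join_last_widen. Qed.

Lemma last_rank w : tnth (rank_tuple (join_last X Y) w) ord_max = rank_transform Y w.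
Proof. by rewrite tnth_mktuple join_last_max. Qed.

Lemma orthant_join_last (u : d.+1.-tuple R) :
  rank_tuple (join_last X Y) @^-1` orthant u =
  [set w | rank_transform Y w <= tnth u ord_max] `&`
  rank_tuple X @^-1` orthant (tuple_init u).
Proof.
apply/seteqP; split=> [w h|w [hY hX] i] /=.
  split; first by have := h ord_max; rewrite last_rank.
  by move=> i; have := h (widen_ord (leqnSn d) i); rewrite -tuple_init_rank !tnth_mktuple.
have [j ->|->] := unliftP ord_max i; last by rewrite last_rank.
rewrite -widen_lift_max.
by have := hX j; rewrite -tuple_init_rank !tnth_mktuple.
Qed.

(** The last coordinate of the margin is set to 1, which bounds every rank. *)
Lemma margin_initE :
  margin_init (connecting_copula (join_last X Y)) = connecting_copula X.
Proof.
apply/funext => u; rewrite /margin_init !connecting_copulaE orthant_join_last.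
congr (fine (P _)).
have -> : tuple_init [tuple of rcons u 1] = u.
  apply: eq_from_tnth => i; rewrite tnth_mktuple !(tnth_nth 0)/= nth_rcons size_tuple.
  by rewrite ltn_ord.
rewrite (_ : [set w | _] = setT) ?setTI//; apply/seteqP; split=> // w _ /=.
rewrite (tnth_nth 0)/= nth_rcons size_tuple ltnn eqxx.
by have /andP[] := rank_transform01 Y w.
Qed.

Lemma measurable_tuple_init : measurable_fun setT (@tuple_init R d).
Proof.
apply/measurable_fun_tnthP => i.
apply: eq_measurable_fun (measurable_tnth (widen_ord (leqnSn d) i)) => v _.
by rewrite /= tnth_mktuple.
Qed.

Variable K : R.-pker (d.-tuple R) ~> R.

Definition rank_cdf (t : R) : T -> R :=
  fun w => fine (K (rank_tuple X w) `[0, t]%classic).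

Let K_fin u F : measurable F -> K u F \is a fin_num.
Proof.
move=> mF; rewrite ge0_fin_numE// (@le_lt_trans _ _ 1%E) ?ltry//.
by rewrite -(@prob_kernel _ _ _ _ _ K u) le_measure ?inE.
Qed.

Let K_le1 u F : measurable F -> fine (K u F) <= 1.
Proof.
move=> mF; rewrite -lee_fin fineK ?K_fin//.
by rewrite -(@prob_kernel _ _ _ _ _ K u) le_measure ?inE.
Qed.

Let mKF F : measurable F -> measurable_fun setT (fun u => fine (K u F)).
Proof. by move=> mF; apply: measurableT_comp => //; exact: measurable_kernel. Qed.

Lemma psiE (p : 2.-tuple R) : psi (connecting_copula (join_last X Y)) K p =
  cdf_moment P rank_cdf (tnth p ord0) (tnth p ord_max).
Proof.
rewrite /psi margin_initE integral_copula//.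
by apply: measurable_funM; exact: mKF.
Qed.

Lemma gini_QE : gini_Q Y X K = moment_gamma P rank_cdf.
Proof.
by congr (4 * _ - 2); apply: eq_Rintegral => t _; rewrite !psiE.
Qed.

Lemma asymmetry_copula t :
  \int[copula_measure (margin_init (connecting_copula (join_last X Y)))]_(u in @cube R d)
     (fine (K u `[0, t]%classic) - (1 - fine (K u `[0, 1 - t]%classic))) ^+ 2 =
  asymmetry P rank_cdf t.
Proof.
rewrite margin_initE integral_copula//; last by move=> u; exact: sqr_ge0.
apply: measurable_funX; apply: measurable_funB; first exact: mKF.
by apply: measurable_funB; [exact: measurable_cst|exact: mKF].
Qed.

Hypothesis hK : is_markov_kernel (connecting_copula (join_last X Y)) K.

(** The defining identity of the kernel, transported from the cube to outcomes. *)
Lemma markov_kernel_rank E F : measurable E -> measurable F ->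
  (\int[P]_(w in rank_tuple X @^-1` E) K (rank_tuple X w) F =
   P (rank_transform Y @^-1` F `&` rank_tuple X @^-1` E))%E.
Proof.
move=> mE mF; have [_ /(_ E F mE mF)] := hK.
rewrite margin_initE ge0_integral_copula//; last exact: measurable_kernel.
move=> ->; rewrite copula_measure_rank; last first.
  rewrite (_ : mkset _ = (setT `&` @tuple_init R d @^-1` E) `&`
      (setT `&` (fun v : d.+1.-tuple R => tnth v ord_max) @^-1` F)).
    by apply: measurableI; [exact: measurable_tuple_init|exact: measurable_tnth].
  by apply/seteqP; split=> v; [case|case=> -[_ ?] [_ ?]].
congr (P _); apply/seteqP; split=> w /=; rewrite tuple_init_rank last_rank.
  by case.
by case.
Qed.

Lemma cond_prob_rank_cdf t :
  cond_prob P (rank_tuple X) [set w | rank_transform Y w <= t] (rank_cdf t).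
Proof.
have mU := measurable_rank_tuple X; have mI := measurable_itv `[0, t].
apply: cond_prob_preimage => //.
- have mUd : measurable_fun setT
      (rank_tuple X : determinedType P (rank_tuple X) -> d.-tuple R).
    by apply/determined_funP => E mE; exact: determined_preimage.
  exact: measurableT_comp (mKF mI) mUd.
- by move=> w; rewrite fine_ge0//= K_le1.
- exact: (measurable_RV_le (rank_transform Y : {RV P >-> R})).
- move=> E mE; rewrite (_ : [set w | _] = rank_transform Y @^-1` `[0, t]); last first.
    apply/seteqP; split=> w /=; rewrite in_itv/=; last by case/andP.
    by move=> ->; have /andP[->] := rank_transform01 Y w.
  rewrite -markov_kernel_rank// /Rintegral [in RHS]integral_mkcond; congr fine.
  apply: eq_integral => w _; rewrite EFinM fineK ?K_fin// patchE indicE.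
  by case: ifPn => _; rewrite ?mule1 ?mule0.
Qed.

Lemma random_cdf_rank_cdf : continuous (distr_fun Y) -> random_cdf P rank_cdf.
Proof.
move=> cY; split.
- by move=> t; exact: determined_fun_measurable (cond_prob_meas (cond_prob_rank_cdf t)).
- by move=> t; exact: cond_prob01 (cond_prob_rank_cdf t).
- move=> s t w st; rewrite fine_le ?K_fin// le_measure ?inE//.
  by apply: subset_itvl; rewrite bnd_simp.
- by move=> t; rewrite (cond_prob_mean (cond_prob_rank_cdf t)) rank_transform_uniform.
Qed.

End copula_kernel.

(** * Extreme values and invariance of Q *)

Section main_properties.
Context (disp : measure_display) (T : measurableType disp) (R : realType)
  (P : probability T R) (d : nat).
Variables (X : 'I_d -> {RV P >-> R}) (Y : {RV P >-> R})
  (K : R.-pker (d.-tuple R) ~> R).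
Hypotheses (cY : continuous (distr_fun Y))
  (hK : is_markov_kernel (connecting_copula (join_last X Y)) K).
Local Notation U := (rank_tuple X).
Local Notation V := (rank_transform Y).

Let cP t := cond_prob_rank_cdf hK t.

(** Completeness of the dependence means that every event [V <= t] is determined
by the ranks of [X], which is when the squares [K_A(u, [0, t])^2] have mean [t]. *)
Lemma gini_Q_eq1 : gini_Q Y X K = 1 <-> completely_dependent Y X.
Proof.
rewrite gini_QE (moment_gamma_eq1 (random_cdf_rank_cdf hK cY)).
apply: iff_trans (determined_factor Y (measurable_vec X)).
have -> : measurable_fun setT ((Y : T -> R) : determinedType P (vec X) -> R) <->
    measurable_fun setT ((Y : T -> R) : determinedType P U -> R).
  by split=> /determined_funP H; apply/determined_funP => E /H;
    rewrite determined_rank_tuple.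
rewrite determined_rank determined_rank_events.
split=> H t t01; have := H t t01.
  move=> Ht; apply/(cond_prob_sqr (cP t)).
  by rewrite [LHS]Ht rank_transform_uniform// clamp01_id.
by move=> /(cond_prob_sqr (cP t)) Ht; rewrite [LHS]Ht rank_transform_uniform// clamp01_id.
Qed.

Let mV t : measurable [set w | V w <= t].
Proof. exact: (measurable_RV_le (V : {RV P >-> R})). Qed.

Let mW t : measurable [set w | 1 - V w <= t].
Proof. exact: (measurable_RV_le (1 - (V : {mfun T >-> R}))). Qed.

(* The two events differ by [V] being equal to [1 - t]. *)
Let eW t : aeq P [set w | 1 - V w <= t] (~` [set w | V w <= 1 - t]).
Proof.
split; last first.
  rewrite (_ : _ `\` _ = set0); first exact: negligible_set0.
  by apply/seteqP; split=> // w /= [/negP]; rewrite -ltNge => h; apply; lra.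
apply: negligibleS (rank_transform_atomless (1 - t) cY) => w /= [h1 /contrapT h2].
by apply/eqP; rewrite eq_le h2/=; lra.
Qed.

(** [K_A(u, [0, t])] and [1 - K_A(u, [0, 1 - t])] are the conditional probabilities
of the events [V <= t] and [V > 1 - t] given the ranks of [X], and the latter event
is almost the same as [1 - V <= t]. *)
Lemma gini_Q_eq0 : gini_Q Y X K = 0 <->
  (forall t, 0 <= t <= 1 -> forall E, measurable E ->
     P ([set w | V w <= t] `&` U @^-1` E) =
     P ([set w | 1 - V w <= t] `&` U @^-1` E)).
Proof.
rewrite gini_QE (moment_gamma_eq0 (random_cdf_rank_cdf hK cY)).
have step t : asymmetry P (rank_cdf X K) t = 0 <-> forall D, determined P U D ->
    P ([set w | V w <= t] `&` D) = P ([set w | 1 - V w <= t] `&` D).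
  rewrite (cond_prob_L2_ext (cP t) (cond_probC (cP (1 - t)))).
  by split=> H D SD; have mD := determined_measurable SD; rewrite H// ![_ `&` D]setIC;
    [apply/esym|]; apply: aeq_probI => //; exact: measurableC.
split=> H t t01.
  move=> E mE; apply: (step t).1; first exact: H.
  exact: determined_preimage (measurable_rank_tuple X) mE.
apply/step => D [mD [E mE DE]].
have mUE := measurable_rank_preimage X mE.
by rewrite (aeq_probI mD mUE (mV t) DE) (aeq_probI mD mUE (mW t) DE); exact: H.
Qed.

(** Under independence both events have conditional probability [t]. *)
Lemma gini_Q_indep : independent_of Y X -> gini_Q Y X K = 0.
Proof.
move=> indep; apply/gini_Q_eq0 => t t01 E mE.
(* The ranks of [X] are a measurable function of [X], as the rank of [Y] is of [Y]. *)
have UE : U @^-1` E = vec X @^-1` ((fun u : d.-tuple R =>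
    [tuple distr_fun (X i) (tnth u i) | i < d]) @^-1` E).
  apply/seteqP; split=> w /=; rewrite (_ : [tuple _ | i < d] = U w)//;
    by apply: eq_from_tnth => i; rewrite !tnth_mktuple.
have mE' : measurable ((fun u : d.-tuple R =>
    [tuple distr_fun (X i) (tnth u i) | i < d]) @^-1` E).
  rewrite -[X in measurable X]setTI; apply: measurable_tuple_fun => // i.
  exact: measurableT_comp (measurable_distr_fun (X i)) (measurable_tnth i).
have indepV F : measurable F ->
    P (V @^-1` F `&` U @^-1` E) = (P (V @^-1` F) * P (U @^-1` E))%E.
  move=> mF; rewrite UE setIC muleC (_ : V @^-1` F = Y @^-1` (distr_fun Y @^-1` F))//.
  apply: indep => //; rewrite -[X in measurable X]setTI.
  exact: measurable_distr_fun.
have E1 : [set w | V w <= t] = V @^-1` `]-oo, t].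
  by apply/seteqP; split=> w /=; rewrite in_itv.
have E2 : [set w | 1 - V w <= t] = V @^-1` `[1 - t, +oo[.
  by apply/seteqP; split=> w /=; rewrite in_itv/= andbT; lra.
rewrite E1 E2 !indepV// -E1 -E2; congr (_ * _)%E.
have mC := measurableC (mV (1 - t)).
rewrite (aeq_prob (mW t) mC (eW t)) -(fineK (fin_num_measure P _ (mV t))).
rewrite -(fineK (fin_num_measure P _ mC)) -setTD fine_probB// setTI.
rewrite (_ : P setT = 1%E); last exact: probability_setT.
rewrite !rank_transform_uniform// !clamp01_id//=; last lra.
by congr EFin; ring.
Qed.

(** [P (- Y <= - y) = P (Y >= y) = 1 - F (y)], since [Y] has no atoms. *)
Lemma rank_transform_opp w :
  rank_transform (- (Y : {mfun T >-> R}) : {RV P >-> R}) w = 1 - V w.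
Proof.
rewrite /rank_transform !distr_funE/=.
have mS := measurable_RV_le Y (Y w).
have mN : measurable [set w' | - Y w' <= - Y w].
  exact: (measurable_RV_le (- (Y : {mfun T >-> R}))).
rewrite (aeq_prob mN (measurableC mS)); last first.
  split; last first.
    rewrite (_ : _ `\` _ = set0); first exact: negligible_set0.
    by apply/seteqP; split=> // w' /= [/negP]; rewrite -ltNge => h; apply; lra.
  apply: negligibleS (rank_transform_atomless (V w) cY) => w' /= [h1 /contrapT h2].
  by rewrite /rank_transform; congr distr_fun; lra.
rewrite -setTD fine_probB// setTI (_ : P setT = 1%E)//; exact: probability_setT.
Qed.

(** The copula of [(X, - Y)] is the distribution function of the ranks of [X] together
with [1 - V], and a law on the cube is known from its distribution function. *)
Lemma gini_Q_eq0_same_copula : gini_Q Y X K = 0 <->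
  same_copula (join_last X Y) (join_last X (- (Y : {mfun T >-> R}))).
Proof.
rewrite gini_Q_eq0.
have WE t : [set w | rank_transform (- (Y : {mfun T >-> R}) : {RV P >-> R}) w <= t] =
    [set w | 1 - V w <= t].
  by apply/seteqP; split=> w /=; rewrite rank_transform_opp.
split=> [H u u01|H t t01 E mE].
  rewrite !connecting_copulaE !orthant_join_last WE H//; exact: measurable_orthant.
set Z := join_last X Y in H *; set Z' := join_last X _ in H.
pose F : set (d.+1.-tuple R) := [set v | tnth v ord_max <= t /\ E (tuple_init v)].
have mF : measurable F.
  rewrite (_ : F = (setT `&` (fun v : d.+1.-tuple R => tnth v ord_max) @^-1`
      `]-oo, t]) `&` (setT `&` @tuple_init R d @^-1` E)).
    apply: measurableI; last exact: measurable_tuple_init.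
    by apply: measurable_tnth => //; exact: measurable_itv.
  apply/seteqP; split=> v /=; rewrite in_itv/=; first by case.
  by case=> -[_ ?] [_ ?].
have FE (Y' : {RV P >-> R}) : rank_tuple (join_last X Y') @^-1` F =
    [set w | rank_transform Y' w <= t] `&` U @^-1` E.
  by apply/seteqP; split=> w; rewrite /F/= tuple_init_rank last_rank.
have law' : is_measure_of (connecting_copula Z) (distribution P (rank_tuple Z')).
  have [c1 c2] := connecting_copula_law Z'.
  by split=> // u u01; rewrite H// c2.
have := copula_measureE law' mF.
by rewrite copula_measure_rank//= /distribution/= /pushforward !FE WE.
Qed.

End main_properties.

(** [psi] is built from conditional probabilities given the ranks of [X], and these
are unique up to null sets once the completed sigma-algebra of [X] is fixed. *)
Lemma gini_Q_determined (disp : measure_display) (T : measurableType disp) (R : realType)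
    (P : probability T R) (d d' : nat)
    (X : 'I_d -> {RV P >-> R}) (X' : 'I_d' -> {RV P >-> R}) (Y : {RV P >-> R})
    (K : R.-pker (d.-tuple R) ~> R) (K' : R.-pker (d'.-tuple R) ~> R) :
  is_markov_kernel (connecting_copula (join_last X Y)) K ->
  is_markov_kernel (connecting_copula (join_last X' Y)) K' ->
  determined P (vec X) = determined P (vec X') ->
  gini_Q Y X K = gini_Q Y X' K'.
Proof.
move=> hK hK' XX'; rewrite !gini_QE.
apply: moment_gamma_ext (cond_prob_rank_cdf hK) (cond_prob_rank_cdf hK').
by rewrite !determined_rank_tuple.
Qed.

Lemma determined_perm (disp : measure_display) (T : measurableType disp) (R : realType)
    (P : probability T R) (d : nat) (X : 'I_d -> {RV P >-> R}) (s : 'S_d) :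
  determined P (vec (fun i => X (s i))) = determined P (vec X).
Proof.
apply/seteqP; split; apply: determined_vec_subset => i.
  exact: determined_coord.
have := determined_coord (Z := fun i => X (s i)) ((s^-1)%g i).
by rewrite permKV.
Qed.

(** A strictly monotone map turns the rays of its argument into rays of its value. *)
Lemma determined_monotone (disp : measure_display) (T : measurableType disp) (R : realType)
    (P : probability T R) (d : nat) (X X' : 'I_d -> {RV P >-> R}) (f : 'I_d -> R -> R) :
  (forall i, continuous (f i)) -> (forall i, strictly_monotone (f i)) ->
  (forall i w, X' i w = f i (X i w)) ->
  determined P (vec X') = determined P (vec X).
Proof.
move=> cf sf X'E; apply/seteqP; split; apply: determined_vec_subset => i.
  have := measurableT_comp (continuous_measurable_fun (cf i))
    (determined_coord (Z := X) i).
  by apply: eq_measurable_fun => w _; rewrite /= X'E.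
apply: measurable_fun_rays => r.
have [fi|fi] := sf i.
  have /(_ measurableT `]-oo, f i r]%classic (measurable_itv _)) :=
    determined_coord (Z := X') i.
  rewrite setTI; congr measurable; apply/seteqP; split=> w /=.
    by rewrite !in_itv/= X'E (le_mono fi).
  by rewrite !in_itv/= X'E (le_mono fi).
have /(_ measurableT `[f i r, +oo[%classic (measurable_itv _)) :=
  determined_coord (Z := X') i.
rewrite setTI; congr measurable; apply/seteqP; split=> w /=.
  by rewrite !in_itv/= andbT X'E (le_nmono fi).
by rewrite !in_itv/= andbT X'E (le_nmono fi).
Qed.

Theorem theorem6 (R : realType) (disp : measure_display)
    (T : measurableType disp) (P : probability T R)
    (d : nat) (hd : (1 <= d)%N)
    (X : 'I_d -> {RV P >-> R}) (Y : {RV P >-> R})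
    (hX : forall i, continuous (distr_fun (X i)))
    (hY : continuous (distr_fun Y))
    (A : d.+1.-tuple R -> R)
    (hA : A = connecting_copula (join_last X Y))
    (K : R.-pker (d.-tuple R) ~> R) (hK : is_markov_kernel A K) :
  (gini_Q Y X K = 2 * (\int[@lebesgue_measure R]_(t in `[0, 1])
      (\int[copula_measure (margin_init A)]_(u in @cube R d)
         (fine (K u `[0, t]%classic) - (1 - fine (K u `[0, 1 - t]%classic))) ^+ 2)))
  /\ 0 <= gini_Q Y X K
  /\ (gini_Q Y X K = 1 <-> completely_dependent Y X)
  /\ (gini_Q Y X K = 0 <-> same_copula (join_last X Y) (join_last X (- (Y : {mfun T >-> R}))))
  /\ (independent_of Y X -> gini_Q Y X K = 0)
  /\ (forall (s : 'S_d) (K' : R.-pker (d.-tuple R) ~> R),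
        is_markov_kernel
          (connecting_copula (join_last (fun i => X (s i)) Y)) K' ->
        gini_Q Y (fun i => X (s i)) K' = gini_Q Y X K)
  /\ (forall (f : 'I_d -> R -> R) (X' : 'I_d -> {RV P >-> R})
        (K' : R.-pker (d.-tuple R) ~> R),
        (forall i, continuous (f i)) ->
        (forall i, strictly_monotone (f i)) ->
        (forall i w, X' i w = f i (X i w)) ->
        is_markov_kernel (connecting_copula (join_last X' Y)) K' ->
        gini_Q Y X' K' = gini_Q Y X K).
Proof.
subst A; have rK := random_cdf_rank_cdf hK hY.
split; [|split; [|split; [|split; [|split; [|split]]]]].
- rewrite gini_QE (moment_gammaE rK); congr (2 * _).
  by apply: eq_Rintegral => t _; rewrite asymmetry_copula.
- by rewrite gini_QE (moment_gamma_ge0 rK).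
- exact: gini_Q_eq1.
- exact: gini_Q_eq0_same_copula.
- exact: gini_Q_indep.
- by move=> s K' hK'; apply: gini_Q_determined hK' hK _; exact: determined_perm.
- move=> f X' K' cf sf X'E hK'; apply: gini_Q_determined hK' hK _.
  exact: determined_monotone cf sf X'E.
Qed.
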